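(* Let $G^{\nu}$ be a wconnected transfinite wgraph of rank $\nu$, $2\le\nu\le\omega$ (possibly $\nu=\vec{\omega}$), let $\rho\le\nu$ be either a natural number or $\omega$ (but not $\vec{\omega}$), and let $S^{\rho}$ be a $\rho$-wsection of $G^{\nu}$. If the enlargement ${}^{*}\!S^{\rho}$ of $S^{\rho}$ has a $\rho$-hypernode that is not in the principal $\rho$-galaxy $\Gamma_0^{\rho}$ of ${}^{*}\!S^{\rho}$, then there exists a two-way infinite sequence of $\rho$-galaxies of ${}^{*}\!S^{\rho}$ totally ordered according to their closeness to $\Gamma_0^{\rho}$.
   Context: **Ranks.** Ranks are ordered $0<1<2<\cdots<\vec{\omega}<\omega$ ($\vec{\omega}$ is a special rank preceding $\omega$; $\omega-1$ means $\vec{\omega}$). Sums of ordinals are natural (Hessenberg) sums, ordinals being in normal form. **Wgraphs.** A $0$-wgraph is a graph $\{X^0,B\}$ with $X^0$ a set of $0$-nodes (also called $0$-wnodes) and $B$ a set of branches (two-element subsets of $X^0$). A (nontrivial) $0$-walk is an alternating sequence $\langle\dots,x_m,b_m,x_{m+1},b_{m+1},\dots\rangle$ of $0$-nodes and branches with $b_m=\{x_m,x_{m+1}\}$, having at least one branch; it is two-ended (finite, ending at $0$-nodes), one-ended, or endless; repetitions are allowed. For each rank $\alpha$, two one-ended $\alpha$-walks are equivalent if they are eventually identical (up to a shift of indices); the equivalence classes are the $\alpha$-wtips, whose members are called representatives. For $\mu\in\{1,2,\dots\}\cup\{\omega\}$, given a $(\mu-1)$-wgraph, partition its set of $(\mu-1)$-wtips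 into nonempty subsets $T_\tau$; for each $\tau$ let $X_\tau$ be empty or a singleton containing an $\alpha$-wnode with $\alpha<\mu$, where no wnode is such an exceptional element of two different wnodes; each $x^\mu_\tau=T_\tau\cup X_\tau$ is a $\mu$-wnode. A wnode embraces itself, its elements, and everything embraced by its exceptional element. $X^\mu$ is the set of $\mu$-wnodes and $\{X^0,B,X^1,\dots,X^\mu\}$ is a $\mu$-wgraph. An $\vec{\omega}$-wgraph has wnode sets $X^\mu$ for all natural $\mu$, and a (possibly empty) set $X^{\vec{\omega}}$ of $\vec{\omega}$-wnodes, i.e. infinite sequences of wnodes of strictly increasing natural ranks, each embracing its predecessor. All $X^\rho$ are nonempty for $\rho\neq\vec{\omega}$. **Walks.** A walk reaches a wnode $x$ at one of its ends if its terminal wnode there is embraced by $x$, or if it is infinite there and the corresponding wtip is embraced by $x$. For $\mu\in\{1,2,\dots\}\cup\{\omega\}$ a $\mu$-walk is an alternating sequence $\langle\dots,x_m,W_m,x_{m+1},W_{m+1},\dots\rangle$ in which interior $x_m$ are $\mu$-wnodes, terminal $x_m$ (if any) are wnodes of rank $\le\mu$, each $W_m$ is a nontrivial walk of rank $\alpha_m<\mu$ reaching $x_m$ and $x_{m+1}$ at its two ends, and for each interior $x_m$ at least one of $W_{m-1},W_m$ reaches $x_m$ through a $(\mu-1)$-wtip. A one-ended $\vec{\omega}$-walk is $\langle x_0,W_0,x_1,W_1,\dots\rangle$ where the $x_m$ are wnodes of strictly increasing natural ranks $\mu_m$ and $W_m$ is a $(\mu_{m+1}-1)$-walk reaching $x_m$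 and reaching $x_{m+1}$ through a $(\mu_{m+1}-1)$-wtip; an endless one is two of these joined at the start; there are no two-ended $\vec{\omega}$-walks. **Lengths and wdistances.** A two-ended $0$-walk has length its number of branch traversals; for natural $\mu$ a one-ended (endless) $\mu$-walk has length $\omega^{\mu+1}$ ($\omega^{\mu+1}\cdot 2$); a one-ended (endless) $\vec{\omega}$-walk has length $\omega^{\omega}$ ($\omega^\omega\cdot 2$); a one-ended (endless) $\omega$-walk has length $\omega^{\omega+1}$ ($\omega^{\omega+1}\cdot2$); a two-ended $\mu$-walk with $\mu\ge1$ has as length the natural sum of the lengths of its $W_m$. The wdistance $d(x,y)$ is the minimum of the lengths of the two-ended walks terminating at $x$ and $y$ (wnodes embraced one by the other are not distinguished), with $d(x,x)=0$. A wgraph is wconnected if any two of its wnodes are joined by a two-ended walk. **Wsections.** A wsubgraph induced by a set $B_s\subset B$ consists of $B_s$, the $0$-nodes incident to it, and the $\gamma$-wnodes embracing a $(\gamma-1)$-wtip with a representative whose branches all lie in $B_s$. A $\rho$-wsection $S^\rho$ of $G^\nu$ is a maximal wsubgraph of $\{X^0,B,\dots,X^\rho\}$ that is $\rho$-wconnected, i.e. any two of its wnodes are the terminal wnodes of a two-ended $\alpha$-walk with $\alpha\le\rho$. The only $\nu$-wsection is $G^\nu$. $S^\rho$ is regarded as a $\rho$-wgraph by itself, with its own wdistance $d$. **Enlargement.** Fix a free ultrafilter $\mathcal F$ on $\mathbb N$. For a wgraph $S$, a $\gamma$-hypernode $\mathbf x=[x_n]$ of the enlargement ${}^{*}\!S$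 is an equivalence class of sequences of $\gamma$-wnodes of $S$ under equality for all $n$ in a member of $\mathcal F$; hyperbranches are the analogous classes $[b_n]$ of sequences of branches, $[\{x_n,y_n\}]$ being incident to the $0$-hypernodes $[x_n],[y_n]$. A standard hypernode is the class of a constant sequence. ${}^{*}\!S$ consists of all hypernodes and hyperbranches. **Galaxies.** For $\rho$ natural or $\rho=\omega$, hypernodes $[x_n],[y_n]$ (of any ranks) of ${}^{*}\!S^\rho$ are $\rho$-limitedly distant if there is $\mu\in\mathbb N$ with $\{n: d(x_n,y_n)\le\omega^\rho\cdot\mu\}\in\mathcal F$. This is an equivalence relation; its classes are the nodal $\rho$-galaxies, and a $\rho$-galaxy is a nodal $\rho$-galaxy together with all hyperbranches whose incident $0$-hypernodes lie in it. The principal $\rho$-galaxy $\Gamma_0^\rho$ is the one whose hypernodes are $\rho$-limitedly distant from a standard hypernode. **Closeness.** For $\rho$-galaxies $\Gamma_a^\rho,\Gamma_b^\rho$ of ${}^{*}\!S^\rho$ different from $\Gamma_0^\rho$, $\Gamma_a^\rho$ is closer to $\Gamma_0^\rho$ than is $\Gamma_b^\rho$ if there are hypernodes $\mathbf y=[y_n]$ in $\Gamma_a^\rho$ and $\mathbf z=[z_n]$ in $\Gamma_b^\rho$ such that, for some $\mathbf x=[x_n]$ in $\Gamma_0^\rho$ and for every $m_0\in\mathbb N$, $\{n: d(z_n,x_n)-d(y_n,x_n)\ge\omega^\rho\cdot m_0\}\in\mathcal F$, where the inequality means $d(z_n,x_n)\ge d(y_n,x_n)+\omega^\rho\cdot m_0$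 (natural sum). (The ranks of these hypernodes are arbitrary ranks other than $\vec{\omega}$; the condition does not depend on the chosen representatives.) A set of $\rho$-galaxies is totally ordered according to closeness to $\Gamma_0^\rho$ if, of every two distinct members, one is closer to $\Gamma_0^\rho$ than the other and this gives a total ordering. A set $A$ is a totally ordered, two-way infinite sequence if there is a bijection $\mathbb Z\to A$ preserving the total ordering of $\mathbb Z$. *)

(* Defs.v *)
From mathcomp Require Import all_boot all_order all_algebra.
From mathcomp Require Import boolp classical_sets functions filter.

Set Implicit Arguments.
Unset Strict Implicit.
Unset Printing Implicit Defensive.

Import Order.TTheory GRing.Theory Num.Theory.
Local Open Scope classical_set_scope.
Local Open Scope ring_scope.

(** * Ranks: 0 < 1 < 2 < ... < vec(omega) < omega *)

Inductive rank : Type :=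
| Fin of nat
| Arrow
| Omega.

Definition rlt (r s : rank) : bool :=
  match r, s with
  | Fin m, Fin n => (m < n)%N
  | Fin _, _ => true
  | Arrow, Omega => true
  | _, _ => false
  end.

Definition rle (r s : rank) : bool := ~~ rlt s r.

(* [omega - 1] is [Arrow]; ranks 0 and [Arrow] have no predecessor. *)
Definition rpred (r : rank) : option rank :=
  match r with
  | Fin n.+1 => Some (Fin n)
  | Omega => Some Arrow
  | _ => None
  end.

(** * Ordinals below omega^(omega.2) *)

(* The pair [(q, p)] stands for the ordinal whose Cantor normal form is
   sum_k omega^(omega + k) . q`_k + sum_k omega^k . p`_k, so that the
   componentwise addition [+%R] is the natural (Hessenberg) sum and
   [a *+ n] is the n-fold natural sum of [a]. *)
Notation ordinal_nf := ({poly nat} * {poly nat})%type.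

Definition poly_lt (p q : {poly nat}) : Prop :=
  exists k : nat, ((p`_k)%R < (q`_k)%R)%N /\
    forall j : nat, (k < j)%N -> p`_j = q`_j.

Definition ord_lt (a b : ordinal_nf) : Prop :=
  poly_lt a.1 b.1 \/ (a.1 = b.1 /\ poly_lt a.2 b.2).

Definition ord_le (a b : ordinal_nf) : Prop := a = b \/ ord_lt a b.

Definition omega_pow (k : nat) : ordinal_nf := (0, 'X^k).
Definition omega_pow_omega_plus (k : nat) : ordinal_nf := ('X^k, 0).

(* omega^rho, for rho natural or omega; it is never used at [Arrow]. *)
Definition omega_pow_rank (rho : rank) : ordinal_nf :=
  if rho is Fin k then omega_pow k else omega_pow_omega_plus 0.

Definition one_ended_length (mu : rank) : ordinal_nf :=
  match mu with
  | Fin k => omega_pow k.+1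
  | Arrow => omega_pow_omega_plus 0
  | Omega => omega_pow_omega_plus 1
  end.

(** * Raw walks over a type of wnodes *)

(* A walk is a family indexed by the integers of the interval with end points
   [lo] and [hi] ([None] = infinite at that end).  [Walk0 lo hi x] is the
   0-walk whose m-th branch is {x m, x (m + 1)}; [WalkS a lo hi x w] is the
   a-walk <..., x m, w m, x (m + 1), ...>.  Values of [x] and [w] outside the
   interval are meaningless. *)
Inductive walk (N : Type) : Type :=
| Walk0 of option int & option int & (int -> N)
| WalkS of rank & option int & option int & (int -> N) & (int -> walk N).

Definition above (lo : option int) (m : int) : bool :=
  if lo is Some l then l <= m else true.
Definition below (hi : option int) (m : int) : bool :=
  if hi is Some h then m <= h else true.

Definition node_pos (lo hi : option int) (m : int) : bool :=
  above lo m && below hi m.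
Definition piece_pos (lo hi : option int) (m : int) : bool :=
  above lo m && below hi (m + 1).
Definition interior_pos (lo hi : option int) (m : int) : bool :=
  above lo (m - 1) && below hi (m + 1).

Section RawWalks.
Variable N : Type.
Implicit Types W V : walk N.

Definition wrank W : rank := if W is WalkS a _ _ _ _ then a else Fin 0.
Definition wlo W : option int :=
  match W with Walk0 lo _ _ => lo | WalkS _ lo _ _ _ => lo end.
Definition whi W : option int :=
  match W with Walk0 _ hi _ => hi | WalkS _ _ hi _ _ => hi end.
Definition wnode W : int -> N :=
  match W with Walk0 _ _ x => x | WalkS _ _ _ x _ => x end.

Definition two_ended W : Prop := wlo W <> None /\ whi W <> None.

Fixpoint wrev W : walk N :=
  match W with
  | Walk0 lo hi x => Walk0 (omap -%R hi) (omap -%R lo) (fun m => x (- m))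
  | WalkS a lo hi x w =>
      WalkS a (omap -%R hi) (omap -%R lo)
        (fun m => x (- m)) (fun m => wrev (w (- m - 1)))
  end.

Definition from (m : int) W : walk N :=
  match W with
  | Walk0 _ hi x => Walk0 (Some m) hi x
  | WalkS a _ hi x w => WalkS a (Some m) hi x w
  end.

(* Equality of walks as alternating sequences, up to a shift of indices. *)
Fixpoint same_walk W V : Prop :=
  match W, V with
  | Walk0 lo hi x, Walk0 lo' hi' y =>
      exists s : int,
        [/\ lo' = omap (+%R s) lo, hi' = omap (+%R s) hi
          & forall m, node_pos lo hi m -> x m = y (s + m)]
  | WalkS a lo hi x w, WalkS b lo' hi' y v =>
      a = b /\ exists s : int,
        [/\ lo' = omap (+%R s) lo, hi' = omap (+%R s) hi,
            forall m, node_pos lo hi m -> x m = y (s + m)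
          & forall m, piece_pos lo hi m -> same_walk (w m) (v (s + m))]
  | _, _ => False
  end.

Definition eventually_identical W V : Prop :=
  match W, V with
  | Walk0 lo None x, Walk0 lo' None y =>
      exists i j : int, [/\ above lo i, above lo' j
        & forall k : nat, x (i + k%:Z) = y (j + k%:Z)]
  | WalkS a lo None x w, WalkS b lo' None y v =>
      a = b /\ exists i j : int, [/\ above lo i, above lo' j
        & forall k : nat, x (i + k%:Z) = y (j + k%:Z) /\
                          same_walk (w (i + k%:Z)) (v (j + k%:Z))]
  | _, _ => False
  end.

Fixpoint wbranches W : set (set N) :=
  match W with
  | Walk0 lo hi x =>
      [set b | exists2 m, piece_pos lo hi m & b = [set x m; x (m + 1)]]
  | WalkS _ lo hi _ w =>
      [set b | exists2 m, piece_pos lo hi m & wbranches (w m) b]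
  end.

Fixpoint wnodes W : set N :=
  match W with
  | Walk0 lo hi x => [set u | exists2 m, node_pos lo hi m & u = x m]
  | WalkS _ lo hi x w =>
      [set u | (exists2 m, node_pos lo hi m & u = x m) \/
               (exists2 m, piece_pos lo hi m & wnodes (w m) u)]
  end.

Fixpoint wlength W : ordinal_nf :=
  match W with
  | Walk0 lo hi _ =>
      match lo, hi with
      | Some l, Some h => omega_pow 0 *+ absz (h - l)
      | None, None => one_ended_length (Fin 0) *+ 2
      | _, _ => one_ended_length (Fin 0)
      end
  | WalkS a lo hi _ w =>
      match lo, hi with
      | Some l, Some h => \sum_(i < absz (h - l)) wlength (w (l + (i : nat)%:Z))
      | None, None => one_ended_length a *+ 2
      | _, _ => one_ended_length a
      end
  end.

End RawWalks.

(** * Wgraphs *)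

(* [wtip_in W x] says that the wtip represented by the one-ended walk [W] is
   an element of [x]; [exc x] is the exceptional element of [x], if any;
   [arrow_seq x] is the sequence of wnodes that [x] consists of, and is
   meaningful only when [x] has rank [Arrow].  The axioms are in [is_wgraph]. *)
Record prewgraph := Prewgraph {
  node :> Type;
  nrank : node -> rank;
  branch : set (set node);
  wtip_in : walk node -> node -> Prop;
  exc : node -> option node;
  arrow_seq : node -> nat -> node }.
Arguments branch {p} _.

Section Wgraphs.
Variable G : prewgraph.
Implicit Types (x y u : G) (W V : walk G).

(* A wnode of rank [Arrow] also embraces whatever its members embrace. *)
Inductive embraces : G -> G -> Prop :=
| embraces_refl x : embraces x x
| embraces_exc x y z : exc x = Some y -> embraces y z -> embraces x z
| embraces_arrow x k z :
    nrank x = Arrow -> embraces (arrow_seq x k) z -> embraces x z.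

(* Wnodes that are not distinguished from one another. *)
Definition undistinguished x y : Prop := embraces x y \/ embraces y x.

(* An endless walk has at its right the wtip of any of its one-ended tails. *)
Definition reaches_right W x : Prop :=
  if whi W is Some h then embraces x (wnode W h)
  else exists (m : int) (y : G),
    [/\ above (wlo W) m, wtip_in (from m W) y & embraces x y].
Definition reaches_left W x : Prop := reaches_right (wrev W) x.

Definition tip_reaches_right W x : Prop := whi W = None /\ reaches_right W x.
Definition tip_reaches_left W x : Prop := wlo W = None /\ reaches_left W x.

(* Conditions on an alternating sequence of rank [a], natural and positive or
   [Omega]; note that an interior wnode of rank [a] is reached through an
   (a-1)-wtip when it is reached by an infinite walk of rank a-1. *)
Definition successor_walk (a : rank) (lo hi : option int)
    (x : int -> G) (w : int -> walk G) : Prop :=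
  [/\ rpred a <> None,
      forall m, node_pos lo hi m -> rle (nrank (x m)) a,
      forall m, interior_pos lo hi m -> nrank (x m) = a,
      forall m, piece_pos lo hi m ->
        [/\ rlt (wrank (w m)) a, reaches_left (w m) (x m)
          & reaches_right (w m) (x (m + 1))]
    & forall m, interior_pos lo hi m ->
        (rpred a = Some (wrank (w (m - 1))) /\
           tip_reaches_right (w (m - 1)) (x m)) \/
        (rpred a = Some (wrank (w m)) /\ tip_reaches_left (w m) (x m))].

(* Ranks increase to the right of [c] and to the left of [c]; a one-ended walk
   has [c] as its end. *)
Definition arrow_walk (lo hi : option int)
    (x : int -> G) (w : int -> walk G) : Prop :=
  (lo = None \/ hi = None) /\
  exists c : int,
    [/\ (if lo is Some l then l = c else True),
        (if hi is Some h then h = c else True),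
        forall m, piece_pos lo hi m -> c <= m ->
          [/\ rlt (nrank (x m)) (nrank (x (m + 1))),
              rlt (nrank (x (m + 1))) Arrow,
              rpred (nrank (x (m + 1))) = Some (wrank (w m)),
              reaches_left (w m) (x m)
            & tip_reaches_right (w m) (x (m + 1))]
      & forall m, piece_pos lo hi m -> m < c ->
          [/\ rlt (nrank (x (m + 1))) (nrank (x m)),
              rlt (nrank (x m)) Arrow,
              rpred (nrank (x m)) = Some (wrank (w m)),
              tip_reaches_left (w m) (x m)
            & reaches_right (w m) (x (m + 1))]].

Fixpoint is_walk W : Prop :=
  match W with
  | Walk0 lo hi x =>
      [/\ exists m, piece_pos lo hi m,
          forall m, node_pos lo hi m -> nrank (x m) = Fin 0
        & forall m, piece_pos lo hi m -> branch [set x m; x (m + 1)]]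
  | WalkS a lo hi x w =>
      [/\ exists m, piece_pos lo hi m,
          forall m, piece_pos lo hi m -> is_walk (w m)
        & if a is Arrow then arrow_walk lo hi x w
          else successor_walk a lo hi x w]
  end.

(* One-ended walks are oriented from their terminal wnode; those that are
   infinite to the left are dealt with through [wrev]. *)
Definition is_one_ended_walk W : Prop :=
  [/\ is_walk W, wlo W <> None & whi W = None].

Record is_wgraph (nu : rank) : Prop := IsWgraph {
  wg_rank : forall x, rle (nrank x) nu;
  wg_nonempty : forall r, rle r nu -> r <> Arrow -> exists x, nrank x = r;
  wg_branch : forall b, branch b ->
    exists x y, [/\ x <> y, nrank x = Fin 0, nrank y = Fin 0
                  & b = [set x; y]];
  (* the wtips of rank mu - 1 are partitioned among the mu-wnodes *)
  wg_tip_rank : forall W x, wtip_in W x ->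
    is_one_ended_walk W /\ rpred (nrank x) = Some (wrank W);
  wg_tip_class : forall W V x,
    is_one_ended_walk W -> is_one_ended_walk V -> eventually_identical W V ->
    wtip_in W x -> wtip_in V x;
  wg_tip_partition : forall W mu, is_one_ended_walk W ->
    rle mu nu -> rpred mu = Some (wrank W) -> exists! x, wtip_in W x;
  wg_tip_nonempty : forall x, rpred (nrank x) <> None -> exists W, wtip_in W x;
  wg_exc_rank : forall x y, exc x = Some y ->
    rpred (nrank x) <> None /\ rlt (nrank y) (nrank x);
  wg_exc_inj : forall x y z, exc x = Some z -> exc y = Some z -> x = y;
  wg_arrow_seq : forall x, nrank x = Arrow -> forall k,
    [/\ rlt (nrank (arrow_seq x k)) Arrow,
        rlt (nrank (arrow_seq x k)) (nrank (arrow_seq x k.+1))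
      & embraces (arrow_seq x k.+1) (arrow_seq x k)];
  wg_arrow_ext : forall x y, nrank x = Arrow -> nrank y = Arrow ->
    arrow_seq x = arrow_seq y -> x = y }.

(** * Wsubgraphs, wdistance, wsections *)

(* A wsubgraph regarded as a wgraph of rank [srank] by itself. *)
Record wsubgraph := Wsubgraph {
  srank : rank;
  sbranch : set (set G);
  snode : set G }.

Definition whole (nu : rank) : wsubgraph := Wsubgraph nu branch setT.

Definition induced (rho : rank) (B : set (set G)) : wsubgraph :=
  Wsubgraph rho B
    [set x | rle (nrank x) rho /\
      ((nrank x = Fin 0 /\ exists2 b, B b & b x) \/
       (exists2 W, wtip_in W x & wbranches W `<=` B))].

Definition walk_in (S : wsubgraph) W : Prop :=
  [/\ is_walk W, rle (wrank W) (srank S), wbranches W `<=` sbranch S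
    & wnodes W `<=` snode S].

Definition joins W x y : Prop :=
  match wlo W, whi W with
  | Some l, Some h =>
      undistinguished (wnode W l) x /\ undistinguished (wnode W h) y
  | _, _ => False
  end.

Definition wconnected (S : wsubgraph) : Prop :=
  forall x y, snode S x -> snode S y -> exists2 W, walk_in S W & joins W x y.

Definition lengths_between (S : wsubgraph) x y : set ordinal_nf :=
  [set a | (undistinguished x y /\ a = 0) \/
           (exists W, [/\ walk_in S W, joins W x y & a = wlength W])].

Definition wdistance (S : wsubgraph) x y : ordinal_nf :=
  xget 0 [set a | lengths_between S x y a /\
                  forall b, lengths_between S x y b -> ord_le a b].

Definition is_wsection (nu rho : rank) (S : wsubgraph) : Prop :=
  (rho = nu /\ S = whole nu) \/
  (rho <> nu /\ exists B : set (set G),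
    [/\ S = induced rho B, B `<=` branch, wconnected (induced rho B)
      & forall B' : set (set G), B `<=` B' -> B' `<=` branch ->
          wconnected (induced rho B') -> B' = B]).

(** * Enlargements and galaxies *)

Definition free_ultrafilter (F : set_system nat) : Prop :=
  UltraFilter F /\ forall n : nat, ~ F [set n].

Section Enlargement.
Variables (F : set_system nat) (S : wsubgraph).

Definition node_seq (g : rank) : set (nat -> G) :=
  [set x : nat -> G | forall n, snode S (x n) /\ nrank (x n) = g].

Definition branch_seq : set (nat -> set G) :=
  [set b | forall n, sbranch S (b n)].

Definition eqclass (T : Type) (D : set (nat -> T)) (x : nat -> T)
  : set (nat -> T) := [set y | D y /\ F [set n | x n = y n]].

(* Hypernodes and hyperbranches are equivalence classes, as sets of sequences. *)
Definition is_hypernode (g : rank) (h : set (nat -> G)) : Prop :=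
  exists2 x : nat -> G, node_seq g x & h = eqclass (node_seq g) x.

Definition is_hyperbranch (c : set (nat -> set G)) : Prop :=
  exists2 b, branch_seq b & c = eqclass branch_seq b.

Definition standard (h : set (nat -> G)) : Prop :=
  exists (g : rank) (u : G),
    node_seq g (fun=> u) /\ h = eqclass (node_seq g) (fun=> u).

Definition incident (c : set (nat -> set G)) (h : set (nat -> G)) : Prop :=
  is_hypernode (Fin 0) h /\
  exists (x y : nat -> G),
    [/\ h x, node_seq (Fin 0) y & c (fun n => [set x n; y n])].

Definition limitedly_distant (h k : set (nat -> G)) : Prop :=
  exists x y : nat -> G, [/\ h x, k y & exists mu : nat,
    F [set n | ord_le (wdistance S (x n) (y n))
                      (omega_pow_rank (srank S) *+ mu)]].

Definition galaxy : Type :=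
  (set (set (nat -> G)) * set (set (nat -> set G)))%type.

(* A nodal galaxy together with the hyperbranches all of whose incident
   0-hypernodes lie in it. *)
Definition galaxy_of (H : set (set (nat -> G))) : galaxy :=
  (H, [set c | is_hyperbranch c /\ forall h, incident c h -> H h]).

Definition is_galaxy (A : galaxy) : Prop :=
  exists g h, is_hypernode g h /\
    A = galaxy_of
      [set k | (exists g', is_hypernode g' k) /\ limitedly_distant h k].

Definition principal_galaxy : galaxy :=
  galaxy_of
    [set k | (exists g, is_hypernode g k) /\
             exists2 h, standard h & limitedly_distant k h].

Definition hypernode_of (A : galaxy) (h : set (nat -> G)) : Prop :=
  A.1 h /\ exists2 g, g <> Arrow & is_hypernode g h.

Definition closer (A B : galaxy) : Prop :=
  [/\ is_galaxy A, A <> principal_galaxy, is_galaxy B, B <> principal_galaxy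
    & exists hy hz hx, exists y z x : nat -> G,
      [/\ hypernode_of A hy /\ hy y, hypernode_of B hz /\ hz z,
          hypernode_of principal_galaxy hx /\ hx x
        & forall m0 : nat,
          F [set n | ord_le (wdistance S (y n) (x n) +
                               omega_pow_rank (srank S) *+ m0)
                            (wdistance S (z n) (x n))]]].

Definition totally_ordered_by_closeness (A : set galaxy) : Prop :=
  [/\ A `<=` is_galaxy,
      forall a, A a -> ~ closer a a,
      forall a b c, A a -> A b -> A c -> closer a b -> closer b c -> closer a c
    & forall a b, A a -> A b -> a <> b -> closer a b \/ closer b a].

Definition two_way_infinite_sequence (A : set galaxy) : Prop :=
  exists f : int -> galaxy,
    set_bij setT A f /\ forall i j : int, i < j <-> closer (f i) (f j).

End Enlargement.

End Wgraphs.

(* Main.v *)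
Require Import Defs.
From mathcomp Require Import all_boot all_order all_algebra.
From mathcomp Require Import boolp classical_sets functions filter.
From mathcomp Require Import zify.

Set Implicit Arguments.
Unset Strict Implicit.
Unset Printing Implicit Defensive.

Import Order.TTheory GRing.Theory Num.Theory.
Local Open Scope classical_set_scope.
Local Open Scope ring_scope.

(** Two-ended walks of rank at most rho have lengths below omega^(rho + 1), and
two such lengths compare, up to one unit, as their coefficients of omega^rho do
([mult]).  Replacing the wdistance d(x, y) by that coefficient gives a natural
number, the coarse wdistance [coarse x y].  Everything in the definition of
galaxies and of closeness can be read off from it, because bounded errors are
invisible there.  Three properties of the coarse wdistance are enough.

- It is symmetric and satisfies the triangle inequality up to an additive
  constant ([coarse_triangle]).
- It takes intermediate values up to a constant, at wnodes of rank rho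
  ([coarse_intermediate]): on a shortest rho-walk from x to y the interior
  wnodes have rank rho, and each piece of the walk, having rank less than rho,
  contributes at most 2 to the coefficient.
- It is unbounded along the given hypernode v = [v_n] outside the principal
  galaxy, when measured from a fixed wnode b of rank rho.

Put K_n = coarse b v_n and let r_n be largest with 2 r_n^2 <= K_n, so that r_n
tends to infinity along the ultrafilter.  For each integer i choose, by the
second property, wnodes u_i(n) of rank rho whose coarse wdistance from b is about
r_n (r_n + i), which lies between 0 and 2 r_n^2 as soon as |i| <= r_n.  These
numbers tend to infinity, and for i < j the j-th exceeds the i-th by at least r_n:
the galaxy of [u_i] is not principal and is closer to the principal galaxy than
that of [u_j].  Conversely the triangle inequality shows that closeness does not
depend on the hypernodes chosen in the two galaxies, so it never holds
for j <= i, and i |-> galaxy of [u_i] is the required two-way infinite sequence.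

The work lies in the triangle inequality, that is, in concatenating walks.  Two
rho-walks that end and start at wnodes embraced by a common wnode cannot simply be
put one after the other, since an interior wnode of a rho-walk has to have rank rho
and has to be reached through a wtip of rank rho - 1.  If this fails at the
junction, the last piece of the first walk and the first piece of the second one,
which have smaller rank, are first concatenated into a single piece; this is an
induction on the rank ([concat_succ], [concat_arrow]).  As that piece has rank less than
rho, its contribution to the coefficient is at most 2 and nothing more
about its length has to be known.  A second difficulty is that wnodes embracing a
common wnode need not be comparable ([embraces_up]); a short loop then
leads from one to the other ([undistinguished_or_loop]). *)

(** * Multiplicity of a power of omega *)

(** The coefficient of omega^rho in a; when a < omega^(rho + 1) it is the quotient
    of a by omega^rho. *)
Definition mult (rho : rank) (a : ordinal_nf) : nat :=
  if rho is Fin k then (a.2`_k)%R else (a.1`_0)%R.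

(** a < omega^(rho + 1). *)
Definition below_next (rho : rank) (a : ordinal_nf) : Prop :=
  if rho is Fin k then a.1 = 0 /\ forall j, (k < j)%N -> a.2`_j = 0
  else forall j, (0 < j)%N -> a.1`_j = 0.

Lemma multD rho a b : mult rho (a + b) = (mult rho a + mult rho b)%N.
Proof. by case: rho => *; rewrite /mult /= coefD. Qed.

Lemma mult0 rho : mult rho 0 = 0%N.
Proof. by case: rho => *; rewrite /mult /= coef0. Qed.

Lemma multMn rho a n : mult rho (a *+ n) = (mult rho a * n)%N.
Proof.
elim: n => [|n IHn]; first by rewrite mulr0n mult0 muln0.
by rewrite mulrS multD IHn mulnS.
Qed.

Lemma mult_sum rho n (f : 'I_n -> ordinal_nf) :
  mult rho (\sum_(i < n) f i) = (\sum_(i < n) mult rho (f i))%N.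
Proof. exact: (big_morph (mult rho) (multD rho) (mult0 rho)). Qed.

Lemma mult_omega_pow_rank rho : mult rho (omega_pow_rank rho) = 1%N.
Proof. by case: rho => [k||] /=; rewrite coefXn eqxx. Qed.

Lemma below_nextD rho a b :
  below_next rho a -> below_next rho b -> below_next rho (a + b).
Proof.
case: rho => [k||] /=.
- move=> [a0 ha] [b0 hb]; split=> [|j hj]; first by rewrite a0 b0 addr0.
  by rewrite coefD ha // hb.
- by move=> ha hb j hj; rewrite coefD ha // hb.
- by move=> ha hb j hj; rewrite coefD ha // hb.
Qed.

Lemma below_next0 rho : below_next rho 0.
Proof. by case: rho => [k||] /=; [split|..] => // *; rewrite coef0. Qed.

Lemma below_nextMn rho a n : below_next rho a -> below_next rho (a *+ n).
Proof.
move=> ha; elim: n => [|n IHn]; first by rewrite mulr0n; exact: below_next0.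
by rewrite mulrS; exact: below_nextD.
Qed.

Lemma below_next_sum rho n (f : 'I_n -> ordinal_nf) :
  (forall i, below_next rho (f i)) -> below_next rho (\sum_(i < n) f i).
Proof.
by move=> hf; apply: big_ind => //; [exact: below_next0|exact: below_nextD].
Qed.

Lemma below_next_omega_pow_rank rho : below_next rho (omega_pow_rank rho).
Proof.
case: rho => [k||] /=; first split=> // j hj.
all: try move=> j hj.
all: by rewrite coefXn; case: eqP => // e; move: hj; rewrite e ?ltnn.
Qed.

Lemma poly_lt_mult_le (p q : {poly nat}) k :
  (forall j, (k < j)%N -> p`_j = 0) -> (forall j, (k < j)%N -> q`_j = 0) ->
  poly_lt p q -> ((p`_k)%R <= (q`_k)%R)%N.
Proof.
move=> hp hq [j [ltj eqj]]; case: (ltngtP k j) => [kj|jk|e].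
- by move: ltj; rewrite hq.
- by rewrite eqj.
- by rewrite e ltnW.
Qed.

Lemma poly_lt_of_mult (p q : {poly nat}) k :
  (forall j, (k < j)%N -> p`_j = 0) -> (forall j, (k < j)%N -> q`_j = 0) ->
  ((p`_k)%R < (q`_k)%R)%N -> poly_lt p q.
Proof. by move=> hp hq lt; exists k; split=> // j kj; rewrite hp ?hq. Qed.

Lemma mult_le rho a b : below_next rho a -> below_next rho b ->
  ord_le a b -> (mult rho a <= mult rho b)%N.
Proof.
move=> ha hb [->//|]; case: rho ha hb => [k||] /=.
- move=> [a0 ha] [b0 hb] [|[_]]; last exact: poly_lt_mult_le.
  by rewrite a0 b0 => -[j [+ _]]; rewrite coef0.
- by move=> ha hb [|[-> _]//]; apply: poly_lt_mult_le.
- by move=> ha hb [|[-> _]//]; apply: poly_lt_mult_le.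
Qed.

(** With a weak inequality the lower-order terms would matter. *)
Lemma ord_le_of_mult rho a b : below_next rho a -> below_next rho b ->
  (mult rho a < mult rho b)%N -> ord_le a b.
Proof.
move=> ha hb lt; right; case: rho ha hb lt => [k||] /=.
- by move=> [a0 ha] [b0 hb] lt; right; rewrite a0 b0; split=> //; apply: poly_lt_of_mult lt.
- by move=> ha hb lt; left; apply: poly_lt_of_mult lt.
- by move=> ha hb lt; left; apply: poly_lt_of_mult lt.
Qed.

Lemma nat_min (T : Type) (A : set T) (f : T -> nat) :
  A !=set0 -> exists2 x, A x & forall y, A y -> (f x <= f y)%N.
Proof.
move=> [x0 Ax0].
have [n] := ubnP (f x0); elim: n x0 Ax0 => // n IHn x0 Ax0 lt.
have [h|/existsNP[y]] := pselect (forall y, A y -> (f x0 <= f y)%N); first by exists x0.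
move=> /not_implyP[Ay /negP]; rewrite -ltnNge => lt'.
by apply: (IHn y Ay); apply: leq_trans lt' _.
Qed.

Definition poly_le (p q : {poly nat}) : Prop := p = q \/ poly_lt p q.

(** Only the coefficients of index less than n vary: minimise the highest of
    them and induct on n. *)
Lemma poly_min_agree n (A : set {poly nat}) : A !=set0 ->
  (forall p q j, A p -> A q -> (n <= j)%N -> p`_j = q`_j) ->
  exists2 p, A p & forall q, A q -> poly_le p q.
Proof.
elim: n A => [|n IHn] A A0 hA.
  case: A0 => p Ap; exists p => // q Aq; left.
  by apply/polyP => j; exact: hA.
have [p0 Ap0 minp0] := nat_min (fun p : {poly nat} => p`_n) A0.
have [||p [Ap ep] minp] := IHn [set p | A p /\ p`_n = p0`_n].
- by exists p0.
- move=> p q j [Ap ep] [Aq eq_]; rewrite leq_eqVlt => /orP[/eqP <-|].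
    by rewrite ep eq_.
  exact: hA.
exists p => // q Aq; have := minp0 q Aq; rewrite /= leq_eqVlt => /orP[/eqP e|lt].
  exact: minp.
right; exists n; split=> [|j nj]; last exact: hA.
by rewrite ep.
Qed.

(** A polynomial with more coefficients is larger, so only the members of
    minimal size compete, and their coefficients agree beyond that size. *)
Lemma poly_min (A : set {poly nat}) : A !=set0 ->
  exists2 p, A p & forall q, A q -> poly_le p q.
Proof.
move=> A0; have [p0 Ap0 minp0] := nat_min (fun p : {poly nat} => size p) A0.
have [||p [Ap sp] minp] := @poly_min_agree (size p0) [set p | A p /\ size p = size p0].
- by exists p0.
- by move=> p q j [_ sp] [_ sq] h; rewrite !nth_default ?sp ?sq.
exists p => // q Aq; have := minp0 q Aq; rewrite /= leq_eqVlt => /orP[/eqP e|lt].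
  exact: minp.
right; exists (size q).-1; have sq : (size q).-1.+1 = size q by apply: prednK; apply: leq_ltn_trans lt.
split=> [|j lj].
  rewrite (nth_default _ (_ : (size p <= _)%N)); last by rewrite sp -ltnS sq.
  by rewrite lt0n -/(lead_coef q) lead_coef_eq0 -size_poly_gt0; apply: leq_ltn_trans lt.
have sj : (size q <= j)%N by rewrite -sq.
by rewrite !nth_default // sp; apply: leq_trans (ltnW lt) sj.
Qed.

(** Ordinals are well-ordered: the minimum defining the wdistance is attained. *)
Lemma ord_min (A : set ordinal_nf) : A !=set0 ->
  exists2 a, A a & forall b, A b -> ord_le a b.
Proof.
move=> [[q0 p0] A0].
have [|q [p1 Aq] minq] := @poly_min [set q | exists p, A (q, p)].
  by exists q0, p0.
have [|p Ap minp] := @poly_min [set p | A (q, p)]; first by exists p1.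
exists (q, p) => // -[q' p'] A'.
case: (minq q' (ex_intro _ p' A')) => [e|lt]; last by right; left.
move: A'; rewrite -e => A'; case: (minp p' A') => [->|lt]; first by left.
by right; right.
Qed.

(** * Ranks and the embracing relation *)

Lemma rle_refl r : rle r r.
Proof. by case: r => // n; rewrite /rle /= ltnn. Qed.

Lemma rlt_irr r : rlt r r = false.
Proof. exact: negbTE (rle_refl r). Qed.

Lemma rlt_le_trans s r t : rlt r s -> rle s t -> rlt r t.
Proof. by case: r s t => [m||] [n||] [p||] //=; rewrite /rle /=; lia. Qed.

Lemma rle_lt_trans s r t : rle r s -> rlt s t -> rlt r t.
Proof. by case: r s t => [m||] [n||] [p||] //=; rewrite /rle /=; lia. Qed.

Lemma rle_trans s r t : rle r s -> rle s t -> rle r t.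
Proof. by case: r s t => [m||] [n||] [p||] //=; rewrite /rle /=; lia. Qed.

Lemma rltW r s : rlt r s -> rle r s.
Proof. by case: r s => [m||] [n||] //=; rewrite /rle /=; lia. Qed.

Lemma rle_eqVlt r s : rle r s -> r = s \/ rlt r s.
Proof.
case: r s => [m||] [n||] //=; rewrite /rle /=; try (by right); try (by left).
by rewrite -leqNgt leq_eqVlt => /orP[/eqP->|->]; [left|right].
Qed.

Lemma rlt_pred a b r : rpred a = Some b -> rlt r a = rle r b.
Proof.
by case: a => [[|n]||] //= [<-]; case: r => [m||]; rewrite /rle //= ltnS leqNgt.
Qed.

Lemma rpred_inj a a' b : rpred a = Some b -> rpred a' = Some b -> a = a'.
Proof. by case: a a' => [[|n]||] [[|m]||] //= [<-] []// ->. Qed.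

Lemma rle_Fin r n : rle r (Fin n) -> exists2 m, r = Fin m & (m <= n)%N.
Proof. by case: r => // m; rewrite /rle /= -leqNgt => h; exists m. Qed.

Section Embracing.
Variables (G : prewgraph) (nu : rank).
Hypothesis hG : is_wgraph G nu.
Implicit Types x y z u : G.

Lemma embraces_trans x y z : embraces x y -> embraces y z -> embraces x z.
Proof.
elim=> {x y} [//|x y w exy _ IH /IH h|x k w rx _ IH /IH h].
- exact: embraces_exc exy h.
- exact: embraces_arrow rx h.
Qed.

Lemma exc_not_arrow x y : exc x = Some y -> nrank x <> Arrow.
Proof. by move=> /(wg_exc_rank hG)[+ _] e; rewrite e. Qed.

Lemma embraces_rank x y : embraces x y -> x = y \/ rlt (nrank y) (nrank x).
Proof.
elim=> {x y} [x|x y z exy _ IH|x k z rx _ IH]; first by left.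
- have [_ lt] := wg_exc_rank hG exy; right.
  by case: IH => [<-//|h]; apply: rlt_le_trans h (rltW lt).
- have [lt _ _] := wg_arrow_seq hG rx k; right; rewrite rx.
  by case: IH => [<-//|h]; apply: rlt_le_trans h (rltW lt).
Qed.

Lemma embraces_rle x y : embraces x y -> rle (nrank y) (nrank x).
Proof. by case/embraces_rank=> [->|/rltW//]; exact: rle_refl. Qed.

Lemma embraces_eq x y : embraces x y -> rle (nrank x) (nrank y) -> x = y.
Proof. by case/embraces_rank=> [//|lt]; rewrite /rle lt. Qed.

Lemma arrow_seq_mono x j k : nrank x = Arrow -> (j <= k)%N ->
  embraces (arrow_seq x k) (arrow_seq x j).
Proof.
move=> rx; elim: k => [|k IHk].
  by rewrite leqn0 => /eqP->; exact: embraces_refl.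
rewrite leq_eqVlt => /orP[/eqP->|/IHk h]; first exact: embraces_refl.
by have [_ _ e] := wg_arrow_seq hG rx k; apply: embraces_trans e h.
Qed.

Lemma arrow_seq_rank x k : nrank x = Arrow ->
  exists2 n, nrank (arrow_seq x k) = Fin n & (k <= n)%N.
Proof.
move=> rx; elim: k => [|k [n rn kn]].
  have [lt _ _] := wg_arrow_seq hG rx 0.
  by move: lt; case E: (nrank _) => [n||] // _; exists n.
have [lt _ _] := wg_arrow_seq hG rx k.+1.
have [_ lt2 _] := wg_arrow_seq hG rx k.
move: lt lt2; rewrite rn; case: (nrank (arrow_seq x k.+1)) => [m||] //= _ h.
by exists m => //; apply: leq_ltn_trans h.
Qed.

Lemma undistinguished_sym x y : undistinguished x y -> undistinguished y x.
Proof. by case; [right|left]. Qed.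

Lemma undistinguished_refl x : undistinguished x x.
Proof. by left; exact: embraces_refl. Qed.

Lemma embraces_inv x z : embraces x z ->
  [\/ x = z, exists2 y, exc x = Some y & embraces y z
    | nrank x = Arrow /\ exists k, embraces (arrow_seq x k) z].
Proof.
case=> {x z} [x|x y z e h|x k z r h]; first by constructor 1.
- by constructor 2; exists y.
- by constructor 3; split=> //; exists k.
Qed.

(** Exceptional elements are unique and the members of an arrow-wnode embrace
    one another, so the wnodes embraced by y form a chain. *)
Lemma embraces_down_linear y u v :
  embraces y u -> embraces y v -> undistinguished u v.
Proof.
have nat_case n (t a b : G) : nrank t = Fin n -> embraces t a -> embraces t b ->
    undistinguished a b.
  move=> rt ta; elim: ta n rt b => {t a} [t|t t' a e t'a IH|t k a r _ _] n rt b tb.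
  - by left.
  - case: (embraces_inv tb) => [<-|[t1 + t1b]|[]].
    + by right; apply: embraces_exc e t'a.
    + rewrite e => -[e1]; rewrite -{}e1 in t1b.
      have [_] := wg_exc_rank hG e; rewrite rt.
      by case rt' : (nrank t') => [m||] // _; exact: IH rt' _ t1b.
    + by rewrite rt.
  - by rewrite r in rt.
elim=> {y u} [y|y y' u e yu IH|y k u r yu IH] yv.
- by left.
- case: (embraces_inv yv) => [<-|[y1]|[/(exc_not_arrow e)//]].
    by right; apply: embraces_exc e yu.
  by rewrite e => -[<-]; exact: IH.
- case: (embraces_inv yv) => [<-|[y1 /exc_not_arrow//]|[_ [j yjv]]].
    by right; apply: embraces_arrow r yu.
  have [m rm _] := arrow_seq_rank (maxn j k) r.
  apply: nat_case rm _ _.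
    exact: embraces_trans (arrow_seq_mono r (leq_maxr _ _)) yu.
  exact: embraces_trans (arrow_seq_mono r (leq_maxl _ _)) yjv.
Qed.

(** No wnode is the exceptional element of two others, hence the only way to
    embrace z without being z is through q.  The exception would be an arrow-wnode
    having z among its members, but its next member strictly embraces z as well and
    therefore embraces q. *)
Lemma embraces_above_exc q z r : exc q = Some z -> embraces r z ->
  r = z \/ embraces r q.
Proof.
have nat_case n (t a : G) : nrank t = Fin n -> exc q = Some a ->
    embraces t a -> t = a \/ embraces t q.
  move=> rt e ta; elim: ta n rt e => {t a} [t|t t' a e' t'a IH|t k a r' _ _] n rt e.
  - by left.
  - right; have [_] := wg_exc_rank hG e'; rewrite rt.
    case rt' : (nrank t') => [m||] // _.
    case: (IH _ rt' e) => [h|h]; last by apply: embraces_exc e' h.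
    move: e'; rewrite h => e'; rewrite (wg_exc_inj hG e e'); exact: embraces_refl.
  - by rewrite r' in rt.
move=> e rz; elim: rz e => {r z} [z|r r' z e' _ IH|r k z rr rz _] e.
- by left.
- right; case: (IH e) => [h|h]; last by apply: embraces_exc e' h.
  move: e'; rewrite h => e'; rewrite (wg_exc_inj hG e e'); exact: embraces_refl.
- right; have [_ lt emb] := wg_arrow_seq hG rr k.
  have [m rm _] := arrow_seq_rank k.+1 rr.
  case: (nat_case _ _ _ rm e (embraces_trans emb rz)) => [h|]; last exact: embraces_arrow.
  by move: lt; rewrite /= h => lt; have := embraces_rle rz; rewrite /rle lt.
Qed.

Lemma embraces_up_linear_nat n q y r : nrank q = Fin n ->
  embraces q y -> embraces r y -> undistinguished q r.
Proof.
move=> rq qy; elim: qy n rq => {q y} [q|q q1 y e q1y IH|q k y rq' _ _] n rq ry.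
- by right.
- have [_] := wg_exc_rank hG e; rewrite rq.
  case rq1 : (nrank q1) => [m||] // _.
  case: (IH _ rq1 ry) => h.
    by left; apply: embraces_exc e h.
  case: (embraces_above_exc e h) => [->|]; last by right.
  by left; apply: embraces_exc e _; exact: embraces_refl.
- by rewrite rq' in rq.
Qed.

(** Two wnodes above y may be incomparable: distinct arrow-wnodes can run
    through the same chain of wnodes of natural ranks, and each may be the
    exceptional element of an omega-wnode.  They then share a wnode of that chain
    of positive rank; positivity matters because such a wnode contains a wtip, along
    which one can leave it and come back. *)
Lemma embraces_up q y r : embraces q y -> embraces r y ->
  undistinguished q r \/
  exists z n, [/\ nrank z = Fin n.+1, embraces q z & embraces r z].
Proof.
move=> qy; elim: qy => {q y} [q|q q1 y e q1y IH|q k y rq qky IH] ry.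
- by left; right.
- case: (IH ry) => [[h|h]|[z [n [rz q1z rz']]]].
  + by left; left; apply: embraces_exc e h.
  + case: (embraces_above_exc e h) => [->|]; last by left; right.
    by left; left; apply: embraces_exc e _; exact: embraces_refl.
  + by right; exists z, n; split=> //; apply: embraces_exc e _.
- have [_ lt emb] := wg_arrow_seq hG rq k.
  have [[//|m] rm _] := arrow_seq_rank k.+1 rq.
  have [h|h] := embraces_up_linear_nat rm (embraces_trans emb qky) ry.
    by left; left; apply: embraces_arrow rq h.
  right; exists (arrow_seq q k.+1), m; split=> //.
  apply: embraces_arrow rq _; exact: embraces_refl.
Qed.

Lemma undistinguished_trans_or x y z :
  undistinguished x y -> undistinguished y z -> undistinguished x z \/
  exists t n, [/\ nrank t = Fin n.+1, embraces x t & embraces z t].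
Proof.
move=> [xy|yx] [yz|zy].
- by left; left; exact: embraces_trans yz.
- exact: embraces_up zy.
- by left; exact: embraces_down_linear yz.
- by left; right; exact: embraces_trans yx.
Qed.

End Embracing.

(** * Reversal of walks *)

Lemma above_rev o (m : int) : above (omap -%R o) m = below o (- m).
Proof. by case: o => //= h; rewrite lerNl. Qed.

Lemma below_rev o (m : int) : below (omap -%R o) m = above o (- m).
Proof. by case: o => //= h; rewrite lerNr. Qed.

Lemma node_pos_rev lo hi m :
  node_pos (omap -%R hi) (omap -%R lo) m = node_pos lo hi (- m).
Proof. by rewrite /node_pos above_rev below_rev andbC. Qed.

Lemma piece_pos_rev lo hi m :
  piece_pos (omap -%R hi) (omap -%R lo) m = piece_pos lo hi (- m - 1).
Proof.
rewrite /piece_pos above_rev below_rev andbC.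
by congr (above _ _ && below _ _); lia.
Qed.

Lemma interior_pos_rev lo hi m :
  interior_pos (omap -%R hi) (omap -%R lo) m = interior_pos lo hi (- m).
Proof.
rewrite /interior_pos above_rev below_rev andbC.
by congr (above _ _ && below _ _); lia.
Qed.

Lemma omap_oppK (o : option int) : omap -%R (omap -%R o) = o.
Proof. by case: o => //= m; rewrite opprK. Qed.

Section Reversal.
Variable N : Type.
Implicit Types W V : walk N.

(** Reversal being an involution that preserves walks, every statement below about
    right ends has its mirror image. *)
Lemma wrevK : involutive (@wrev N).
Proof.
elim=> [lo hi x|a lo hi x w IH] /=; rewrite !omap_oppK.
  by congr Walk0; apply: funext => m; rewrite opprK.
congr WalkS; apply: funext => m; first by rewrite opprK.
by rewrite IH; congr w; lia.
Qed.

Lemma wrank_rev W : wrank (wrev W) = wrank W.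
Proof. by case: W. Qed.

Lemma wlo_rev W : wlo (wrev W) = omap -%R (whi W).
Proof. by case: W. Qed.

Lemma whi_rev W : whi (wrev W) = omap -%R (wlo W).
Proof. by case: W. Qed.

Lemma wnode_rev W m : wnode (wrev W) m = wnode W (- m).
Proof. by case: W. Qed.

Lemma wbranches_rev W : wbranches (wrev W) = wbranches W.
Proof.
elim: W => [lo hi x|a lo hi x w IH] /=; apply/seteqP; split=> b [m].
- rewrite piece_pos_rev => h ->; exists (- m - 1) => //.
  by rewrite setUC; congr ([set x _] `|` [set x _]); lia.
- move=> h ->; exists (- m - 1).
    by rewrite piece_pos_rev; move: h; congr (is_true (piece_pos _ _ _)); lia.
  by rewrite setUC; congr ([set x _] `|` [set x _]); lia.
- by rewrite piece_pos_rev IH => h hb; exists (- m - 1).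
- move=> h hb; exists (- m - 1).
    by rewrite piece_pos_rev; move: h; congr (is_true (piece_pos _ _ _)); lia.
  by rewrite IH; move: hb; congr (wbranches (w _) b); lia.
Qed.

Lemma wnodes_rev W : wnodes (wrev W) = wnodes W.
Proof.
have sub V : (forall u, wnodes V u -> wnodes (wrev V) u) ->
   (forall u, wnodes (wrev V) u -> wnodes V u) -> wnodes (wrev V) = wnodes V.
  by move=> h1 h2; apply/seteqP; split.
elim: W => [lo hi x|a lo hi x w IH]; apply: sub => u /=.
- move=> [m h ->]; exists (- m); last by rewrite opprK.
  by rewrite node_pos_rev opprK.
- by move=> [m]; rewrite node_pos_rev => h ->; exists (- m).
- case=> -[m h].
    move=> ->; left; exists (- m); last by rewrite opprK.
    by rewrite node_pos_rev opprK.
  move=> hu; right; exists (- m - 1).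
    by rewrite piece_pos_rev; move: h; congr (is_true (piece_pos _ _ _)); lia.
  by rewrite IH; move: hu; congr (wnodes (w _) u); lia.
- case=> -[m]; first by rewrite node_pos_rev => h ->; left; exists (- m).
  by rewrite piece_pos_rev IH => h hu; right; exists (- m - 1).
Qed.

End Reversal.

Section Reaching.
Variable G : prewgraph.
Implicit Types (x y u : G) (W V : walk G).

Lemma reaches_left_rev W x : reaches_left (wrev W) x = reaches_right W x.
Proof. by rewrite /reaches_left wrevK. Qed.

Lemma reaches_right_rev W x : reaches_right (wrev W) x = reaches_left W x.
Proof. by []. Qed.

Lemma tip_reaches_left_rev W x :
  tip_reaches_left (wrev W) x <-> tip_reaches_right W x.
Proof.
rewrite /tip_reaches_left /tip_reaches_right wlo_rev reaches_left_rev.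
by split=> -[h ?]; split=> //; move: h; case: (whi W).
Qed.

Lemma tip_reaches_right_rev W x :
  tip_reaches_right (wrev W) x <-> tip_reaches_left W x.
Proof. by rewrite -tip_reaches_left_rev wrevK. Qed.

Lemma reaches_right_fin W h x : whi W = Some h ->
  reaches_right W x <-> embraces x (wnode W h).
Proof. by rewrite /reaches_right => ->. Qed.

Lemma reaches_left_fin W l x : wlo W = Some l ->
  reaches_left W x <-> embraces x (wnode W l).
Proof.
move=> e; rewrite /reaches_left (@reaches_right_fin _ (- l)); last by rewrite whi_rev e.
by rewrite wnode_rev opprK.
Qed.

Lemma successor_walk_rev a lo hi (x : int -> G) w :
  successor_walk a lo hi x w ->
  successor_walk a (omap -%R hi) (omap -%R lo)
    (fun m => x (- m)) (fun m => wrev (w (- m - 1))).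
Proof.
move=> [h1 h2 h3 h4 h5]; split=> //.
- by move=> m; rewrite node_pos_rev; exact: h2.
- by move=> m; rewrite interior_pos_rev; exact: h3.
- move=> m; rewrite piece_pos_rev => /h4[r l r']; rewrite wrank_rev; split=> //.
    by rewrite reaches_left_rev; move: r'; congr (reaches_right _ (x _)); lia.
  by rewrite reaches_right_rev; move: l; congr (reaches_left _ (x _)); lia.
- move=> m; rewrite interior_pos_rev => /h5; rewrite !wrank_rev.
  have -> : - (m - 1) - 1 = - m :> int by lia.
  by case=> -[e t]; [right|left]; split=> //;
    [rewrite tip_reaches_left_rev|rewrite tip_reaches_right_rev].
Qed.

Lemma arrow_walk_rev lo hi (x : int -> G) w :
  arrow_walk lo hi x w ->
  arrow_walk (omap -%R hi) (omap -%R lo)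
    (fun m => x (- m)) (fun m => wrev (w (- m - 1))).
Proof.
move=> [h0 [c [h1 h2 h3 h4]]]; split.
  by case: h0 => ->; [right|left].
exists (- c); split.
- by case: hi h2 {h0 h3 h4} => //= h ->.
- by case: lo h1 {h0 h3 h4} => //= h ->.
- move=> m; rewrite piece_pos_rev wrank_rev => pm cm.
  have [|r1 r2 r3 r4 r5] := h4 (- m - 1) pm; first by lia.
  have e1 : - m - 1 + 1 = - m :> int by lia.
  have e2 : - (m + 1) = - m - 1 :> int by lia.
  rewrite e2; rewrite e1 in r1 r5; split=> //; first by rewrite reaches_left_rev.
  by rewrite tip_reaches_right_rev.
- move=> m; rewrite piece_pos_rev wrank_rev => pm cm.
  have [|r1 r2 r3 r4 r5] := h3 (- m - 1) pm; first by lia.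
  have e1 : - m - 1 + 1 = - m :> int by lia.
  have e2 : - (m + 1) = - m - 1 :> int by lia.
  rewrite e2; rewrite e1 in r1 r2 r3 r5; split=> //.
  by rewrite tip_reaches_left_rev.
Qed.

Lemma is_walk_rev W : is_walk W -> is_walk (wrev W).
Proof.
have pieces lo hi : (exists m, piece_pos lo hi m) ->
    exists m, piece_pos (omap -%R hi) (omap -%R lo) m.
  move=> [m h]; exists (- m - 1); rewrite piece_pos_rev.
  by move: h; congr (is_true (piece_pos _ _ _)); lia.
elim: W => [lo hi x|a lo hi x w IH] /= [h1 h2 h3]; split.
- exact: pieces h1.
- by move=> m; rewrite node_pos_rev; exact: h2.
- move=> m; rewrite piece_pos_rev => /h3.
  by rewrite setUC; congr (branch ([set x _] `|` [set x _])); lia.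
- exact: pieces h1.
- by move=> m; rewrite piece_pos_rev => /h2; exact: IH.
- case: a h3 => [n||] h3; [|exact: arrow_walk_rev|];
    exact: successor_walk_rev.
Qed.

End Reaching.

(** * Tails and wtips *)

Lemma rpred_le a b r : rpred a = Some b -> rlt b r -> rle a r.
Proof.
by case: a => [[|n]||] //= [<-]; case: r => [m||] //=; rewrite /rle //= -leqNgt.
Qed.

Lemma int_upper_bound (a b c : int) : exists i : int, [/\ a <= i, b <= i & c <= i].
Proof.
exists (Num.max (Num.max a b) c : int).
by rewrite !le_max !lexx ?orbT; split.
Qed.

Section Tails.
Variable N : Type.
Implicit Types W V Z : walk N.

(** Agreement from some index on, up to a shift.  Unlike [eventually_identical]
    it also applies to walks that are finite on the right, where it says that the
    terminal wnodes coincide. *)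
Definition same_tail V Z : Prop :=
  match V, Z with
  | Walk0 lo hi x, Walk0 lo' hi' x' =>
      exists n s : int, [/\ hi' = omap (+%R s) hi, node_pos lo hi n,
        above lo' (s + n)
        & forall m, n <= m -> below hi m -> x' (s + m) = x m]
  | WalkS a lo hi x w, WalkS b lo' hi' x' w' =>
      a = b /\ exists n s : int, [/\ hi' = omap (+%R s) hi, node_pos lo hi n,
        above lo' (s + n),
        forall m, n <= m -> below hi m -> x' (s + m) = x m
        & forall m, n <= m -> below hi (m + 1) -> w' (s + m) = w m]
  | _, _ => False
  end.

Lemma same_walk_refl W : same_walk W W.
Proof.
have o0 (o : option int) : o = omap (+%R 0) o by case: o => //= m; rewrite add0r.
elim: W => [lo hi x|a lo hi x w IH] /=.
  by exists 0; split=> // m _; rewrite add0r.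
by split=> //; exists 0; split=> // m _; rewrite add0r.
Qed.

Lemma same_tail_rank V Z : same_tail V Z -> wrank Z = wrank V.
Proof. by case: V Z => [lo hi x|a lo hi x w] [lo' hi' x'|b lo' hi' x' w'] //= [->]. Qed.

Lemma same_tail_whi V Z : same_tail V Z -> whi V = None <-> whi Z = None.
Proof.
case: V Z => [lo hi x|a lo hi x w] [lo' hi' x'|b lo' hi' x' w'] //=.
  by move=> [n [s [-> _ _ _]]]; case: hi.
by move=> [_ [n [s [-> _ _ _ _]]]]; case: hi.
Qed.

Lemma same_tail_from V Z m m' : same_tail V Z -> whi V = None ->
  eventually_identical (from m V) (from m' Z).
Proof.
case: V Z => [lo hi x|a lo hi x w] [lo' hi' x'|b lo' hi' x' w'] //=.
  move=> [n [s [-> _ _ e]]] iV; rewrite iV /= in e *.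
  have [i [hm hn hs]] := int_upper_bound m n (m' - s).
  exists i, (s + i); split=> [//||k]; first by lia.
  by rewrite -addrA e //; lia.
move=> [-> [n [s [-> _ _ e e']]]] iV; rewrite iV /= in e e' *; split=> //.
have [i [hm hn hs]] := int_upper_bound m n (m' - s).
exists i, (s + i); split=> [//||k]; first by lia.
rewrite -addrA e // ?e' //; [|by lia..].
by split=> //; exact: same_walk_refl.
Qed.

Lemma same_tail_refl V : (exists n, node_pos (wlo V) (whi V) n) -> same_tail V V.
Proof.
have o0 (o : option int) : o = omap (+%R 0) o by case: o => //= m; rewrite add0r.
case: V => [lo hi x|a lo hi x w] /= [n hn].
  exists n, 0; split=> //; last by move=> m _ _; rewrite add0r.
  by rewrite add0r; case/andP: hn.
split=> //; exists n, 0; split=> //; try by move=> m _ _; rewrite add0r.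
by rewrite add0r; case/andP: hn.
Qed.

Lemma wbranches_from m V : above (wlo V) m -> wbranches (from m V) `<=` wbranches V.
Proof.
have sub lo hi k : above lo m -> piece_pos (Some m) hi k -> piece_pos lo hi k.
  move=> h /andP[/= mk bk]; rewrite /piece_pos bk andbT.
  by case: lo h => //= l h; lia.
case: V => [lo hi x|a lo hi x w] /= h b [k kp hb]; exists k => //; exact: sub h kp.
Qed.

End Tails.

Section WalkFacts.
Variable G : prewgraph.
Implicit Types (x y u : G) (W V Z : walk G).

Lemma successor_walk_sub a lo hi lo' hi' (x : int -> G) w :
  (forall m, above lo' m -> above lo m) -> (forall m, below hi' m -> below hi m) ->
  successor_walk a lo hi x w -> successor_walk a lo' hi' x w.
Proof.
move=> hlo hhi [h1 h2 h3 h4 h5]; split=> //.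
- by move=> m /andP[/hlo u /hhi v]; apply: h2; rewrite /node_pos u v.
- by move=> m /andP[/hlo u /hhi v]; apply: h3; rewrite /interior_pos u v.
- by move=> m /andP[/hlo u /hhi v]; apply: h4; rewrite /piece_pos u v.
- by move=> m /andP[/hlo u /hhi v]; apply: h5; rewrite /interior_pos u v.
Qed.

Lemma is_walk_succ a lo hi (x : int -> G) w : rpred a <> None ->
  is_walk (WalkS a lo hi x w) <->
  [/\ exists m, piece_pos lo hi m,
      forall m, piece_pos lo hi m -> is_walk (w m)
    & successor_walk a lo hi x w].
Proof. by case: a. Qed.

Lemma rank_not_arrow_pred a lo hi (x : int -> G) w :
  is_walk (WalkS a lo hi x w) -> a <> Arrow -> rpred a <> None.
Proof. by case: a => [n||] //= [_ _ [h _ _ _ _]]. Qed.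

(** A tail of an endless arrow-walk is an arrow-walk only beyond the index from
    which the ranks increase; this is why the tails start at c. *)
Lemma from_one_ended W : is_walk W -> whi W = None ->
  exists c, above (wlo W) c /\ forall m, c <= m -> is_one_ended_walk (from m W).
Proof.
have sub lo c m k : above lo c -> c <= m -> above (Some m) k -> above lo k.
  by case: lo => //= l; lia.
have ex lo : exists c, above lo c.
  by case: lo => [l|]; [exists l => /=; lia|exists 0].
have pm (m : int) : exists k, piece_pos (Some m) None k.
  by exists m; rewrite /piece_pos /= andbT.
case: W => [lo hi x|a lo hi x w] /= hW hi0.
  rewrite {}hi0 in hW *; have [c hc] := ex lo; exists c; split=> // m cm.
  case: hW => h1 h2 h3; split=> //; split=> //.
    by move=> k /andP[mk _]; apply: h2; rewrite /node_pos (sub _ _ _ _ hc cm mk).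
  by move=> k /andP[mk _]; apply: h3; rewrite /piece_pos (sub _ _ _ _ hc cm mk).
rewrite {}hi0 in hW *; case: hW => h1 h2 h3.
have [aA|aA] := pselect (a = Arrow).
  rewrite {}aA in h3 *; case: h3 => _ [c [hc _ h4 h5]].
  have hc' : above lo c by case: lo hc {h1 h2 h4 h5} => //= l ->.
  exists c; split=> // m cm; split=> //; split=> //.
    by move=> k /andP[mk _]; apply: h2; rewrite /piece_pos (sub _ _ _ _ hc' cm mk).
  split; first by right.
  exists m; split=> // k /andP[mk _] hk.
    apply: h4; last by lia.
    by rewrite /piece_pos (sub _ _ _ _ hc' cm mk).
  by move: mk => /=; lia.
have {}h3 : successor_walk a lo None x w by case: a aA h3 => // /(_ erefl).
have ra : rpred a <> None by case: h3.
have [c hc] := ex lo; exists c; split=> // m cm; split=> //.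
apply/(is_walk_succ _ _ _ _ ra); split=> //.
  by move=> k /andP[mk _]; apply: h2; rewrite /piece_pos (sub _ _ _ _ hc cm mk).
apply: successor_walk_sub h3 => // k; exact: sub hc cm.
Qed.

Lemma node_exists W : is_walk W -> exists n, node_pos (wlo W) (whi W) n.
Proof.
case: W => [lo hi x|a lo hi x w] /= [[n /andP[h1 h2]] _ _]; exists n;
  by rewrite /node_pos h1; case: hi h2 => //= h; lia.
Qed.

Lemma terminal_rank W h : is_walk W -> whi W = Some h ->
  rle (nrank (wnode W h)) (wrank W).
Proof.
have lem lo (k : int) : (exists m, piece_pos lo (Some k) m) -> above lo (k - 1).
  by move=> [m /andP[]]; case: lo => //= l; lia.
case: W => [lo hi x|a lo hi x w] /=.
  move=> [/[swap] h2 /[swap] _ +] e; rewrite e => /lem al; rewrite h2 //.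
  by rewrite e /node_pos /= lexx andbT; case: lo al {h2} => //= l; lia.
move=> + e; rewrite {}e => -[/lem al h2 h3].
have [aA|aA] := pselect (a = Arrow).
  rewrite {}aA in h3 *; case: h3 => h0 [c [hc hc' h4 h5]].
  have [||r1 r2 _ _ _] := h5 (h - 1).
  + by rewrite /piece_pos al /=; lia.
  + by rewrite -hc'; lia.
  apply: rltW; rewrite subrK in r1; apply: rlt_le_trans r1 (rltW r2).
have {}h3 : successor_walk a lo (Some h) x w by case: a aA h3 => // /(_ erefl).
case: h3 => _ h3 _ _ _; apply: h3; rewrite /node_pos /= lexx andbT.
by case: lo al {h2} => //= l; lia.
Qed.

End WalkFacts.

Section Tips.
Variables (G : prewgraph) (nu : rank).
Hypothesis hG : is_wgraph G nu.
Implicit Types (x y u : G) (W V Z : walk G).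

Lemma same_tail_tip V Z m y : is_walk Z -> same_tail V Z -> whi V = None ->
  wtip_in (from m V) y -> exists m', above (wlo Z) m' /\ wtip_in (from m' Z) y.
Proof.
move=> wZ st iV ty.
have iZ : whi Z = None by apply/(same_tail_whi st).
have [c [ac hc]] := from_one_ended wZ iZ; exists c; split=> //.
apply: (wg_tip_class hG _ _ _ ty); [|exact: hc|exact: same_tail_from].
exact: (wg_tip_rank hG ty).1.
Qed.

(** What a walk reaches depends only on its tail, since a wtip is closed under
    eventual identity. *)
Lemma same_tail_reaches V Z x : is_walk Z -> same_tail V Z ->
  reaches_right V x -> reaches_right Z x.
Proof.
move=> wZ st; case iV : (whi V) => [h|].
  rewrite (reaches_right_fin _ iV) => xh.
  case: V Z st iV xh {wZ} => [lo hi y|a lo hi y w] [lo' hi' y'|b lo' hi' y' w'] //=.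
    move=> [n [s [e hn _ e']]] hh; rewrite hh in e hn e' *; rewrite /reaches_right /= e /= e' //.
      by case/andP: hn.
    by rewrite /=.
  move=> [_ [n [s [e hn _ e' _]]]] hh; rewrite hh in e hn e' *; rewrite /reaches_right /= e /= e' //.
    by case/andP: hn.
  by rewrite /=.
rewrite /reaches_right iV; have /(same_tail_whi st) -> := iV.
move=> [m [y [am ty xy]]]; have [m' [am' ty']] := same_tail_tip wZ st iV ty.
by exists m', y.
Qed.

(** All the tails of an infinite walk represent the same wtip. *)
Lemma tip_node_unique V m m' y y' : is_walk V -> whi V = None ->
  wtip_in (from m V) y -> wtip_in (from m' V) y' -> y = y'.
Proof.
move=> wV iV ty ty'.
have [ow ry] := wg_tip_rank hG ty; have [ow' _] := wg_tip_rank hG ty'.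
have ty2 : wtip_in (from m' V) y.
  apply: (wg_tip_class hG ow ow' _ ty).
  exact/same_tail_from/iV/same_tail_refl/node_exists.
have rank_from k : wrank (from k V) = wrank V by case: (V).
have [||u [_ uniq]] := wg_tip_partition hG ow' (mu := nrank y).
- exact: wg_rank hG y.
- by rewrite ry !rank_from.
by rewrite -(uniq _ ty2) (uniq _ ty').
Qed.

Variables (rho : rank) (B : set (set G)) (N : set G).
Hypothesis tip_closed : forall W x, wtip_in W x -> wbranches W `<=` B ->
  rle (nrank x) rho -> N x.

Definition walk_within W : Prop :=
  [/\ is_walk W, wbranches W `<=` B & wnodes W `<=` N].

Lemma walk_within_rev W : walk_within W -> walk_within (wrev W).
Proof.
by move=> [h1 h2 h3]; split; [exact: is_walk_rev|rewrite wbranches_rev|rewrite wnodes_rev].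
Qed.

Lemma walk_within_node W m : walk_within W -> node_pos (wlo W) (whi W) m ->
  N (wnode W m).
Proof.
by move=> [_ _]; case: W => [lo hi x|a lo hi x w] /= h hm; apply: h => /=;
  [exists m|left; exists m].
Qed.

Lemma terminal_pos W h : is_walk W -> whi W = Some h -> node_pos (wlo W) (whi W) h.
Proof.
case: W => [lo hi x|a lo hi x w] /= [[m /andP[h1 h2]] _ _] e; rewrite e in h2 *;
  rewrite /node_pos /= lexx andbT; case: lo h1 => //= l; move: h2 => /=; lia.
Qed.

(** The wnodes that a walk reaches on the right are those embracing one of them,
    the terminal wnode or the wnode to which the wtip belongs.  In the second case
    the wnode lies in the wsubgraph because its wtip has a representative there. *)
Lemma right_node W x0 : walk_within W -> reaches_right W x0 ->
  (whi W = None -> rlt (wrank W) rho) ->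
  exists u, [/\ N u, reaches_right W u,
    forall x, reaches_right W x -> embraces x u
    & (exists2 h, whi W = Some h & u = wnode W h) \/
      (whi W = None /\ rpred (nrank u) = Some (wrank W))].
Proof.
move=> wW rx lt; case iW : (whi W) => [h|].
  exists (wnode W h); split.
  - by apply: (walk_within_node wW); apply: terminal_pos iW; case: wW.
  - by rewrite (reaches_right_fin _ iW); exact: embraces_refl.
  - by move=> x; rewrite (reaches_right_fin _ iW).
  - by left; exists h.
have := rx; rewrite {1}/reaches_right iW => -[m [u [am tu _]]].
have [ou ru] := wg_tip_rank hG tu.
have rank_from k : wrank (from k W) = wrank W by case: (W).
rewrite rank_from in ru.
case: wW => wW bW nW.
exists u; split.
- apply: (tip_closed tu) (rpred_le ru (lt iW)).
  exact: subset_trans (wbranches_from am) bW.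
- by rewrite /reaches_right iW; exists m, u; split=> //; exact: embraces_refl.
- move=> x; rewrite /reaches_right iW => -[m' [u' [_ tu' xu']]].
  by rewrite (tip_node_unique wW iW tu tu').
- by right.
Qed.

Lemma tip_reaches_rank W x : tip_reaches_right W x ->
  exists2 u, embraces x u & rpred (nrank u) = Some (wrank W).
Proof.
move=> [iW]; rewrite /reaches_right iW => -[m [u [_ tu xu]]].
exists u => //; have [_ ->] := wg_tip_rank hG tu; by case: (W).
Qed.

(** A walk of rank less than a, read as a two-ended a-walk with a single piece. *)
Definition wrap a u v W : walk G :=
  WalkS a (Some 0) (Some 1) (fun m => if m <= 0 then u else v) (fun=> W).

Lemma walk_within_wrap a u v W : rpred a <> None -> walk_within W -> rlt (wrank W) a ->
  reaches_left W u -> reaches_right W v -> N u -> N v ->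
  rle (nrank u) a -> rle (nrank v) a -> walk_within (wrap a u v W).
Proof.
move=> ra [wW bW nW] lt ru rv Nu Nv lu lv.
have pp m : piece_pos (Some 0) (Some 1) m -> m = 0 by move=> /andP[/=]; lia.
split.
- apply/is_walk_succ => //; split=> //; first by exists 0.
  split=> //.
  + by move=> m _; case: ifP.
  + by move=> m /andP[/=]; lia.
  + by move=> m /pp->.
  + by move=> m /andP[/=]; lia.
- by move=> b [m _]; exact: bW.
- by move=> z [[m _ ->]|[m _]]; [case: ifP|exact: nW].
Qed.

(** Terminal wnodes that lose nothing of what W reaches are those
    of [right_node], on both sides. *)
Lemma lift_walk a W x0 y0 : walk_within W -> rlt (wrank W) a -> rpred a <> None ->
  rle a rho -> reaches_left W x0 -> reaches_right W y0 ->
  exists u v, [/\ walk_within (wrap a u v W),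
     forall x, reaches_left W x -> reaches_left (wrap a u v W) x,
     forall x, reaches_right W x -> reaches_right (wrap a u v W) x,
     reaches_left W u & reaches_right W v].
Proof.
move=> wW lt ra ar rx ry.
have lr := rlt_le_trans lt ar.
have rk Z u : is_walk Z -> wrank Z = wrank W ->
    (exists2 h, whi Z = Some h & u = wnode Z h) \/
      (whi Z = None /\ rpred (nrank u) = Some (wrank Z)) -> rle (nrank u) a.
  move=> wZ rZ [[h iZ ->]|[_]]; rewrite ?rZ.
    by apply: rle_trans (terminal_rank wZ iZ) _; rewrite rZ; exact: rltW.
  by move=> e; exact: rpred_le e lt.
have [v [Nv rv vmin rkv]] := right_node wW ry (fun _ => lr).
have [|u [Nu ru umin rku]] := right_node (walk_within_rev wW) rx.
  by rewrite wrank_rev.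
exists u, v; split=> //.
apply: walk_within_wrap => //.
  by apply: rk rku; [apply: is_walk_rev; case: wW|exact: wrank_rev].
by apply: rk rkv => //; case: wW.
Qed.

End Tips.

(** * Joining two walks by a piece *)

Definition shift_end (e : int) (o : option int) := omap (fun i => i - e) o.

Lemma above_shift e o m : above (shift_end e o) m = above o (m + e).
Proof. by case: o => //= l; rewrite lerBlDr. Qed.

Lemma below_shift e o m : below (shift_end e o) m = below o (m + e).
Proof. by case: o => //= l; rewrite lerBrDr. Qed.

Section Join.
Variables (N : Type) (a : rank) (lo hi : option int).
Variables (xv xw : int -> N) (wv ww : int -> walk N) (e f : int) (p : walk N).

(** The walk that follows the first walk up to its index e - 1, then p, then the
    second walk from its index f on.  It is indexed so that the two halves meet at
    the wnodes -1 and 0 and that p has index -1. *)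
Definition join_nodes m := if m < 0 then xv (m + e) else xw (m + f).
Definition join_pieces m :=
  if m < -1 then wv (m + e) else if m == -1 then p else ww (m + f).
Definition join_walk :=
  WalkS a (shift_end e lo) (shift_end f hi) join_nodes join_pieces.

Lemma join_wbranches (B : set (set N)) :
  (forall m, above lo m -> m + 1 < e -> wbranches (wv m) `<=` B) ->
  wbranches p `<=` B ->
  (forall m, f <= m -> below hi (m + 1) -> wbranches (ww m) `<=` B) ->
  wbranches join_walk `<=` B.
Proof.
move=> hv hp hw b [m /andP[]]; rewrite above_shift below_shift /join_pieces => hl hh.
case: ifP => m1; first by apply: hv => //; lia.
case: eqP => m2; first exact: hp.
apply: hw; first by lia.
by move: hh; congr (is_true (below _ _)); lia.
Qed.

Lemma join_wnodes (M : set N) :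
  (forall m, above lo m -> m < e -> M (xv m)) ->
  (forall m, above lo m -> m + 1 < e -> wnodes (wv m) `<=` M) ->
  wnodes p `<=` M ->
  (forall m, f <= m -> below hi m -> M (xw m)) ->
  (forall m, f <= m -> below hi (m + 1) -> wnodes (ww m) `<=` M) ->
  wnodes join_walk `<=` M.
Proof.
move=> nv hv hp nw hw u [] [m /andP[]]; rewrite above_shift below_shift => hl hh.
  move=> ->; rewrite /join_nodes; case: ifP => m0.
    by apply: nv => //; lia.
  by apply: nw => //; lia.
rewrite /join_pieces.
case: ifP => m1; first by apply: hv => //; lia.
case: eqP => m2; first exact: hp.
apply: hw; first by lia.
by move: hh; congr (is_true (below _ _)); lia.
Qed.

Lemma join_tail_right lo' : above lo' f -> below hi f -> above lo (e - 1) ->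
  same_tail (WalkS a lo' hi xw ww) join_walk.
Proof.
move=> h1 h2 h3; split=> //; exists f, (- f); split.
- by rewrite /shift_end; case: (hi) => //= i; rewrite addrC.
- by rewrite /node_pos h1 h2.
- by rewrite above_shift; case: (lo) h3 => //= l; lia.
- move=> m fm _; rewrite /join_nodes ifF; last by lia.
  by congr xw; lia.
- move=> m fm _; rewrite /join_pieces ifF; last by lia.
  by rewrite ifF; [congr ww|]; lia.
Qed.

Lemma join_tail_left hi' : above lo (e - 1) -> below hi' (e - 1) -> below hi f ->
  same_tail (wrev (WalkS a lo hi' xv wv)) (wrev join_walk).
Proof.
move=> h1 h2 h3; split=> //; exists (1 - e), e; split.
- by rewrite /shift_end; case: (lo) => //= i; congr Some; lia.
- rewrite node_pos_rev /node_pos.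
  have -> : - (1 - e) = e - 1 by lia.
  by rewrite h1 h2.
- rewrite above_rev below_shift; case: (hi) h3 => //= l; lia.
- move=> m em _; rewrite /join_nodes ifT; last by lia.
  by congr xv; lia.
- move=> m em _; rewrite /join_pieces ifT; last by lia.
  by congr (wrev (wv _)); lia.
Qed.

End Join.

(** The first walk ends at h and the second starts at l, so at most one piece of
    each is dropped when p is inserted. *)
Lemma join_mult (N : Type) rho a (l0 h0 e f h l : int) (xv xw : int -> N) wv ww p :
  l0 <= h - 1 -> l + 1 <= h0 -> e = h \/ e = h + 1 -> f = l \/ f = l + 1 ->
  (mult rho (wlength (join_walk a (Some l0) (Some h0) xv xw wv ww e f p)) <=
   mult rho (wlength (WalkS a (Some l0) (Some h) xv wv)) +
   mult rho (wlength (WalkS a (Some l) (Some h0) xw ww)) +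
   mult rho (wlength p))%N.
Proof.
move=> hl0 hh0 he hf.
have sum_split (F : int -> nat) (n1 n2 : nat) :
    (\sum_(i < n1 + n2) F (i : nat)%:Z = \sum_(i < n1) F (i : nat)%:Z +
      \sum_(i < n2) F (n1%:Z + (i : nat)%:Z)%R)%N.
  by rewrite big_split_ord.
have sum_le (F : int -> nat) (n1 n2 : nat) : (n1 <= n2)%N ->
    (\sum_(i < n1) F (i : nat)%:Z <= \sum_(i < n2) F (i : nat)%:Z)%N.
  by move=> /subnKC <-; rewrite sum_split leq_addr.
rewrite /= !mult_sum /shift_end.
pose n1 := absz (e - 1 - l0)%R; pose n2 := absz (h0 - f)%R.
have -> : absz (h0 - f - (l0 - e))%R = (n1 + (1 + n2))%N by rewrite /n1 /n2; lia.
pose F i := mult rho (wlength (join_pieces wv ww e f p (l0 - e + i))).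
rewrite (eq_bigr (fun i : 'I_(n1 + (1 + n2)) => F (i : nat)%:Z)) //.
rewrite (sum_split F) (sum_split (fun i => F (n1%:Z + i))) big_ord1 addnA.
have -> : F (n1%:Z + (@nat_of_ord 1 ord0)%:Z) = mult rho (wlength p).
  rewrite /F /join_pieces ifF; last by rewrite /n1 /=; lia.
  by rewrite ifT // /n1 /=; lia.
rewrite addnAC leq_add2r; apply: leq_add.
  rewrite (eq_bigr (fun i : 'I_n1 => mult rho (wlength (wv (l0 + (i : nat)%:Z))))).
    apply: (sum_le (fun i => mult rho (wlength (wv (l0 + i))))).
    by rewrite /n1; lia.
  move=> [i lti] _ /=; rewrite /F /join_pieces ifT; last by move: lti; rewrite /n1; lia.
  by congr (mult rho (wlength (wv _))); lia.
have hn : (absz (h0 - l)%R  = absz (f - l)%R + n2)%N by rewrite /n2; lia.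
rewrite hn (sum_split (fun i => mult rho (wlength (ww (l + i))))).
apply: leq_trans (leq_addl _ _); apply: eq_leq.
apply: eq_bigr => -[i lti] _ /=.
rewrite /F /join_pieces ifF; last by rewrite /n1; lia.
rewrite ifF; last by rewrite /n1; lia.
by congr (mult rho (wlength (ww _))); rewrite /n1; lia.
Qed.

Section JoinWalks.
Variable G : prewgraph.
Implicit Types (x y u : G) (W V Z : walk G).

(** Away from the junction the conditions are those of the two halves; the last
    two hypotheses are the conditions at the wnodes -1 and 0, wherever these are
    interior. *)
Lemma join_successor_walk a lo hi (xv xw : int -> G) wv ww (e f : int) p :
  successor_walk a lo (Some (e - 1)) xv wv ->
  successor_walk a (Some f) hi xw ww ->
  rlt (wrank p) a -> reaches_left p (xv (e - 1)) -> reaches_right p (xw f) ->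
  (above lo (e - 2) -> nrank (xv (e - 1)) = a /\
     ((rpred a = Some (wrank (wv (e - 2))) /\
         tip_reaches_right (wv (e - 2)) (xv (e - 1))) \/
      (rpred a = Some (wrank p) /\ tip_reaches_left p (xv (e - 1))))) ->
  (below hi (f + 1) -> nrank (xw f) = a /\
     ((rpred a = Some (wrank p) /\ tip_reaches_right p (xw f)) \/
      (rpred a = Some (wrank (ww f)) /\ tip_reaches_left (ww f) (xw f)))) ->
  successor_walk a (shift_end e lo) (shift_end f hi) (join_nodes xv xw e f)
    (join_pieces wv ww e f p).
Proof.
move=> [h1 h2 h3 h4 h5] [_ k2 k3 k4 k5] rp lp rp' cl cr.
have bl m : m < 0 -> below (Some (e - 1)) (m + e) by move=> /=; lia.
have al m : 0 <= m -> above (Some f) (m + f) by move=> /=; lia.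
split=> //.
- move=> m /andP[]; rewrite above_shift below_shift => am bm.
  rewrite /join_nodes; case: ifP => m0.
    by apply: h2; rewrite /node_pos am bl.
  by apply: k2; rewrite /node_pos bm al //; lia.
- move=> m /andP[]; rewrite above_shift below_shift => am bm.
  rewrite /join_nodes; case: ifP => m0.
    have [m1|m1] : m = -1 \/ m + 1 < 0 by lia.
      move: am; rewrite m1.
      have -> : -1 - 1 + e = e - 2 by lia.
      have -> : -1 + e = e - 1 by lia.
    by move=> /cl[].
    apply: h3; rewrite /interior_pos.
    have -> : m + e - 1 = m - 1 + e by lia.
    have -> : m + e + 1 = m + 1 + e by lia.
    by rewrite am bl.
  have [m1|m1] : m = 0 \/ 0 <= m - 1 by lia.
    move: bm; rewrite m1 !add0r.
    have -> : 1 + f = f + 1 by lia.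
    by move=> /cr[].
  apply: k3; rewrite /interior_pos.
  have -> : m + f - 1 = m - 1 + f by lia.
  have -> : m + f + 1 = m + 1 + f by lia.
    by rewrite bm al.
- move=> m /andP[]; rewrite above_shift below_shift => am bm.
  rewrite /join_nodes /join_pieces.
  have [m1|[m1|m1]] : m = -1 \/ m + 1 < 0 \/ 0 <= m by lia.
  + rewrite m1 /=; split=> //.
      by move: lp; congr (reaches_left _ (xv _)); lia.
    by move: rp'; congr (reaches_right _ (xw _)); lia.
  + rewrite !ifT; [|lia..].
    have := h4 (m + e); have -> : m + e + 1 = m + 1 + e by lia.
    apply; rewrite /piece_pos am.
    have -> : m + e + 1 = m + 1 + e by lia.
    by rewrite bl.
  + rewrite !ifF; [|lia..].
    have := k4 (m + f); have -> : m + f + 1 = m + 1 + f by lia.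
    apply; rewrite /piece_pos al //.
    have -> : m + f + 1 = m + 1 + f by lia.
    by rewrite bm.
- move=> m /andP[]; rewrite above_shift below_shift => am bm.
  rewrite /join_nodes /join_pieces.
  have [m1|[m1|[m1|m1]]] : m = -1 \/ m = 0 \/ m + 1 < 0 \/ 0 <= m - 1 by lia.
  + rewrite m1 /=; have e2 : -1 - 1 + e = e - 2 by lia.
    have e1 : -1 + e = e - 1 by lia.
    by move: am; rewrite m1 e1 e2 => /cl[].
  + rewrite m1 /= !add0r.
    move: bm; rewrite m1 add0r.
    have -> : 1 + f = f + 1 by lia.
    by move=> /cr[].
  + rewrite !ifT; [|lia..].
    have e2 : m + e - 1 = m - 1 + e by lia.
    have := h5 (m + e); rewrite e2; apply; rewrite /interior_pos e2 am.
    have -> : m + e + 1 = m + 1 + e by lia.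
    by rewrite bl.
  + rewrite !ifF; [|lia..].
    have e2 : m + f - 1 = m - 1 + f by lia.
    have := k5 (m + f); rewrite e2; apply; rewrite /interior_pos e2 al //.
    have -> : m + f + 1 = m + 1 + f by lia.
    by rewrite bm.
Qed.

Variables (B : set (set G)) (M : set G).

Lemma walk_within_succ a lo hi (x : int -> G) w : rpred a <> None ->
  walk_within B M (WalkS a lo hi x w) <->
  [/\ exists m, piece_pos lo hi m,
      forall m, piece_pos lo hi m -> walk_within B M (w m),
      forall m, node_pos lo hi m -> M (x m)
    & successor_walk a lo hi x w].
Proof.
move=> ra; split.
  move=> [/(is_walk_succ _ _ _ _ ra)[h1 h2 h3] hB hM]; split=> //.
    move=> m hm; split; first exact: h2.
      by move=> b hb; apply: hB; exists m.
    by move=> b hb; apply: hM; right; exists m.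
  by move=> m hm; apply: hM; left; exists m.
move=> [h1 h2 h3 h4]; split.
- by apply/(is_walk_succ _ _ _ _ ra); split=> // m /h2[].
- by move=> b [m /h2[_ + _]]; apply.
- by move=> u [[m /h3 + ->//]|[m /h2[_ _ +]]]; apply.
Qed.

Lemma join_within a lo (h l : int) hi (xv xw : int -> G) wv ww (e f : int) p :
  rpred a <> None -> e = h \/ e = h + 1 -> f = l \/ f = l + 1 ->
  walk_within B M (WalkS a lo (Some h) xv wv) ->
  walk_within B M (WalkS a (Some l) hi xw ww) ->
  walk_within B M p ->
  rlt (wrank p) a -> reaches_left p (xv (e - 1)) -> reaches_right p (xw f) ->
  (above lo (e - 2) -> nrank (xv (e - 1)) = a /\
     ((rpred a = Some (wrank (wv (e - 2))) /\
         tip_reaches_right (wv (e - 2)) (xv (e - 1))) \/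
      (rpred a = Some (wrank p) /\ tip_reaches_left p (xv (e - 1))))) ->
  (below hi (f + 1) -> nrank (xw f) = a /\
     ((rpred a = Some (wrank p) /\ tip_reaches_right p (xw f)) \/
      (rpred a = Some (wrank (ww f)) /\ tip_reaches_left (ww f) (xw f)))) ->
  let Z := join_walk a lo hi xv xw wv ww e f p in
  [/\ walk_within B M Z, same_tail (WalkS a (Some l) hi xw ww) Z
    & same_tail (wrev (WalkS a lo (Some h) xv wv)) (wrev Z)].
Proof.
move=> ra he hf /(walk_within_succ _ _ _ _ ra)[[mv mvP] hv2 hv3 hv4].
move=> /(walk_within_succ _ _ _ _ ra)[[mw mwP] hw2 hw3 hw4] hp rp lp rp' cl cr Z.
have al : above lo (e - 1).
  by case/andP: mvP => /=; case: (lo) => //= i; lia.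
have bh : below hi f.
  by case/andP: mwP => /=; case: (hi) => //= i; lia.
split.
- have swv : successor_walk a lo (Some (e - 1)) xv wv.
    by apply: successor_walk_sub hv4 => // m /=; lia.
  have sww : successor_walk a (Some f) hi xw ww.
    by apply: successor_walk_sub hw4 => // m /=; lia.
  split.
  + apply/(is_walk_succ _ _ _ _ ra); split.
    * exists (-1); rewrite /piece_pos above_shift below_shift.
      have -> : -1 + e = e - 1 by lia.
      have -> : -1 + 1 + f = f by lia.
    by rewrite al.
    * move=> m /andP[]; rewrite above_shift below_shift /join_pieces => am bm.
      case: ifP => m1.
        by case: (hv2 (m + e)) => //; rewrite /piece_pos am /=; lia.
      case: eqP => m2; first by case: hp.
      case: (hw2 (m + f)) => //; rewrite /piece_pos /=.
      have -> : m + f + 1 = m + 1 + f by lia.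
      by rewrite bm andbT; lia.
    * exact: join_successor_walk.
  + apply: join_wbranches.
    * by move=> m am me; case: (hv2 m) => //; rewrite /piece_pos am /=; lia.
    * by case: hp.
    * move=> m fm bm; case: (hw2 m) => //; rewrite /piece_pos bm /=; lia.
  + apply: join_wnodes.
    * by move=> m am me; apply: hv3; rewrite /node_pos am /=; lia.
    * by move=> m am me; case: (hv2 m) => //; rewrite /piece_pos am /=; lia.
    * by case: hp.
    * by move=> m fm bm; apply: hw3; rewrite /node_pos bm /=; lia.
    * by move=> m fm bm; case: (hw2 m) => //; rewrite /piece_pos bm /=; lia.
- by apply: join_tail_right => //=; lia.
- by apply: join_tail_left => //=; lia.
Qed.

End JoinWalks.

(** * Concatenation of walks, by induction on the rank *)

Lemma rpred_Fin r n : rpred r = Some (Fin n) -> r = Fin n.+1.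
Proof. by case: r => [[|m]||] //= [->]. Qed.

Section Concat.
Variables (G : prewgraph) (nu : rank).
Hypothesis hG : is_wgraph G nu.
Implicit Types (x y u t : G) (W V Z : walk G).
Variables (rho : rank) (B : set (set G)) (M : set G).
Hypothesis tip_closed : forall W x, wtip_in W x -> wbranches W `<=` B ->
  rle (nrank x) rho -> M x.
Local Notation wk := (walk_within B M).

Lemma reaches_right_mono W x y : embraces y x -> reaches_right W x -> reaches_right W y.
Proof.
rewrite /reaches_right; case: (whi W) => [h|] yx.
  exact: embraces_trans.
by move=> [m [u [h1 h2 xu]]]; exists m, u; split=> //; exact: embraces_trans xu.
Qed.

Lemma reaches_left_mono W x y : embraces y x -> reaches_left W x -> reaches_left W y.
Proof. exact: reaches_right_mono. Qed.

(** Z can replace V as the last piece of a walk of rank b + 1.  The second clause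
    is there because an interior wnode of such a walk may have to be reached through
    a wtip of rank exactly b. *)
Definition keeps_right b V Z : Prop :=
  (forall x, reaches_right V x -> reaches_right Z x) /\
  (wrank V = b -> whi V = None -> wrank Z = b /\ whi Z = None).

Definition keeps_left b V Z : Prop := keeps_right b (wrev V) (wrev Z).

Lemma keeps_right_refl b V : keeps_right b V V.
Proof. by []. Qed.

Lemma keeps_right_trans b V Z Y :
  keeps_right b V Z -> keeps_right b Z Y -> keeps_right b V Y.
Proof.
move=> [h1 h2] [k1 k2]; split; first by move=> x /h1/k1.
by move=> r i; have [r' i'] := h2 r i; exact: k2.
Qed.

Lemma same_tail_keeps b V Z : is_walk Z -> same_tail V Z -> keeps_right b V Z.
Proof.
move=> wZ st; split=> [x|r i]; first exact: (same_tail_reaches hG wZ st).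
by rewrite (same_tail_rank st); split=> //; apply/(same_tail_whi st).
Qed.

Lemma keeps_right_lt b V Z : rlt (wrank V) b ->
  (forall x, reaches_right V x -> reaches_right Z x) -> keeps_right b V Z.
Proof. by move=> lt h; split=> // e; move: lt; rewrite e rlt_irr. Qed.

Lemma keeps_tip b V Z x : keeps_right b V Z -> wrank V = b -> tip_reaches_right V x ->
  wrank Z = b /\ tip_reaches_right Z x.
Proof. by move=> [h1 h2] r [i rx]; have [r' i'] := h2 r i; split=> //; split=> //; exact: h1. Qed.

Definition has_concat b V W : Prop :=
  exists Z, [/\ wk Z, rle (wrank Z) b, keeps_left b V Z & keeps_right b W Z].

(** Walks of rank at most b that are finite at the junction can be concatenated
    within rank b. *)
Definition can_concat b : Prop := forall V W t,
  wk V -> wk W -> rle (wrank V) b -> rle (wrank W) b ->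
  whi V <> None -> wlo W <> None -> reaches_right V t -> reaches_left W t ->
  (exists x, reaches_left V x) -> (exists x, reaches_right W x) -> has_concat b V W.

(** The same when the walks may arrive at the junction through wtips, of rank less
    than b.  Wtips of rank b are excluded: a wnode reached through one of them has to
    remain a wnode of the resulting walk, which then has rank b + 1. *)
Definition can_glue b : Prop := forall V W t,
  wk V -> wk W -> rle (wrank V) b -> rle (wrank W) b ->
  (whi V = None -> rlt (wrank V) b) -> (wlo W = None -> rlt (wrank W) b) ->
  reaches_right V t -> reaches_left W t ->
  (exists x, reaches_left V x) -> (exists x, reaches_right W x) -> has_concat b V W.

Lemma has_concat_rev b V W : has_concat b (wrev W) (wrev V) -> has_concat b V W.
Proof.
move=> [Z [h1 h2 h3 h4]]; exists (wrev Z); split.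
- exact: walk_within_rev.
- by rewrite wrank_rev.
- by rewrite /keeps_left wrevK.
- by move: h3; rewrite /keeps_left wrevK.
Qed.

(** A wtip of rank less than b belongs to a wnode of rank at most b, which can be
    added as a terminal wnode. *)
Lemma end_finite b V t x0 : b <> Omega -> rle b rho -> wk V -> rle (wrank V) b ->
  (whi V = None -> rlt (wrank V) b) -> reaches_left V x0 -> reaches_right V t ->
  exists V', [/\ wk V', rle (wrank V') b, whi V' <> None, reaches_right V' t
    & keeps_left b V V'].
Proof.
move=> bO br wV lV iV lx rt; case eV : (whi V) => [h|].
  by exists V; split=> //; rewrite eV.
have lt := iV eV.
have [n en] : exists n, wrank V = Fin n.
  by move: lt bO; case: (wrank V) (b) => [n||] [m||] //; exists n.
have le : rle (Fin n.+1) b by apply: (@rpred_le _ (Fin n)); [|rewrite -en].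
have ltn : rlt (wrank V) (Fin n.+1) by rewrite en /=.
have [u [v [h1 h2 h3 _ _]]] := lift_walk hG tip_closed wV ltn (a := Fin n.+1) ltac:(by [])
  (rle_trans le br) lx rt.
exists (wrap (Fin n.+1) u v V); split=> //; first exact: h3.
by apply: keeps_right_lt; rewrite ?wrank_rev.
Qed.

Lemma glue_of_concat b : b <> Omega -> rle b rho -> can_concat b -> can_glue b.
Proof.
move=> bO br cc V W t wV wW lV lW iV iW rV rW [x xV] [z zW].
have [V' [h1 h2 h3 h4 h5]] := end_finite bO br wV lV iV xV rV.
have [||||W' [k1 k2 k3 k4 k5]] := @end_finite b (wrev W) t z bO br (walk_within_rev wW).
- by rewrite wrank_rev.
- by rewrite wrank_rev whi_rev; move: iW; case: (wlo W).
- by rewrite reaches_left_rev.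
- by [].
have [|||||||Z [z1 z2 z3 z4]] := cc V' (wrev W') t h1 (walk_within_rev k1) h2.
- by rewrite wrank_rev.
- by [].
- by rewrite wlo_rev; case: (whi W') k3.
- by [].
- by rewrite reaches_left_rev.
- by exists x; apply: h5.1.
- by exists z; move: k5.1; rewrite wrevK; apply.
exists Z; split=> //; first exact: keeps_right_trans z3.
by apply: keeps_right_trans z4; move: k5; rewrite /keeps_left wrevK.
Qed.

(** Among two wnodes embraced by t, one that has the highest admissible rank
    embraces the other. *)
Lemma embraces_of_top_rank a y y' t : embraces t y -> embraces t y' ->
  nrank y = a -> rle (nrank y') a -> embraces y y'.
Proof.
move=> ty ty' ry ry'; case: (embraces_down_linear hG ty ty') => // h.
rewrite (embraces_eq hG h) ?ry //; exact: embraces_refl.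
Qed.

(** Branches meet in 0-wnodes, and the 0-wnodes embraced by a single wnode
    coincide. *)
Lemma concat_zero lo h l hi (xv xw : int -> G) t :
  wk (Walk0 lo (Some h) xv) -> wk (Walk0 (Some l) hi xw) ->
  embraces t (xv h) -> embraces t (xw l) ->
  let Z := Walk0 (shift_end h lo) (shift_end l hi) (join_nodes xv xw h l) in
  [/\ wk Z, same_tail (Walk0 (Some l) hi xw) Z
    & same_tail (wrev (Walk0 lo (Some h) xv)) (wrev Z)].
Proof.
move=> wV wW tv tw Z.
have al : above lo (h - 1).
  case: wV => -[[m /andP[] /=]]; case: (lo) => //= i; lia.
have bh : below hi (l + 1).
  case: wW => -[[m /andP[] /=]]; case: (hi) => //= i; lia.
have al0 : above lo h by case: (lo) al => //= i; lia.
have bh0 : below hi l by case: (hi) bh => //= i; lia.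
have e : xv h = xw l.
  have rv : nrank (xv h) = Fin 0.
    by case: wV => -[_ + _] _ _; apply; rewrite /node_pos al0 /=.
  have rw : nrank (xw l) = Fin 0.
    by case: wW => -[_ + _] _ _; apply; rewrite /node_pos bh0 /= lexx.
  by apply: (embraces_eq hG); rewrite ?rv ?rw //; apply: embraces_of_top_rank tv tw rv _; rewrite rw.
have nodeP m : node_pos (shift_end h lo) (shift_end l hi) m ->
  (node_pos lo (Some h) (m + h) /\ join_nodes xv xw h l m = xv (m + h)) \/
  (node_pos (Some l) hi (m + l) /\ join_nodes xv xw h l m = xw (m + l)).
  move=> /andP[]; rewrite above_shift below_shift => am bm.
  rewrite /join_nodes; case: ifP => m0; [left|right]; split=> //.
    by rewrite /node_pos am /=; lia.
  by rewrite /node_pos bm /= andbT; lia.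
have pieceP m : piece_pos (shift_end h lo) (shift_end l hi) m ->
  (piece_pos lo (Some h) (m + h) /\
     [set join_nodes xv xw h l m; join_nodes xv xw h l (m + 1)] =
     [set xv (m + h); xv (m + h + 1)]) \/
  (piece_pos (Some l) hi (m + l) /\
     [set join_nodes xv xw h l m; join_nodes xv xw h l (m + 1)] =
     [set xw (m + l); xw (m + l + 1)]).
  move=> /andP[]; rewrite above_shift below_shift => am bm.
  have ee k : m + 1 + k = m + k + 1 :> int by lia.
  rewrite /join_nodes; have [m0|[m0|m0]] : m = -1 \/ m + 1 < 0 \/ 0 <= m by lia.
  + left; split; first by rewrite /piece_pos am /=; lia.
    rewrite m0 /= add0r -e; congr ([set _] `|` [set xv _]); lia.
  + left; split; first by rewrite /piece_pos am /=; lia.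
    by rewrite !ifT; [rewrite ee|lia..].
  + right; split; first by rewrite /piece_pos -ee bm /= andbT; lia.
    by rewrite !ifF; [rewrite ee|lia..].
case: wV wW => -[_ v1 v2] v3 v4 [[_ w1 w2] w3 w4].
split; first split.
- split.
  + exists 0; rewrite /piece_pos above_shift below_shift !add0r al0 addrC bh //.
  + by move=> m /nodeP[[/v1 + ->]|[/w1 + ->]].
  + by move=> m /pieceP[[/v2 + ->]|[/w2 + ->]].
- move=> b [m /pieceP[[pm ->] ->|[pm ->] ->]].
    by apply: v3; exists (m + h).
  by apply: w3; exists (m + l).
- move=> u [m /nodeP[[pm ->] ->|[pm ->] ->]].
    by apply: v4; exists (m + h).
  by apply: w4; exists (m + l).
- exists l, (- l); split.
  + by rewrite /shift_end; case: (hi) => //= i; rewrite addrC.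
  + by rewrite /node_pos /= lexx.
  + by rewrite above_shift; case: (lo) al0 => //= i; lia.
  + move=> m fm _; rewrite /join_nodes ifF; last by lia.
    by congr xw; lia.
- exists (- h), h; split.
  + by rewrite /shift_end; case: (lo) => //= i; congr Some; lia.
  + by rewrite node_pos_rev opprK /node_pos al0 /=.
  + by rewrite above_rev below_shift; case: (hi) bh0 => //= i; lia.
  + move=> m em _; rewrite /join_nodes.
    have [m0|m0] : m = - h \/ - h < m by lia.
      by rewrite m0 ifF; [rewrite opprK e; congr xw|]; lia.
    by rewrite ifT; [congr xv|]; lia.
Qed.

(** If one of the two walks reaches the junction through a wtip of rank a - 1, its
    terminal wnode there has rank a, embraces the other terminal wnode and can be
    an interior wnode.  Otherwise the two pieces adjacent to the junction are glued
    into one.  The indices e and f tell which pieces have been replaced by p; they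
    and p are exposed for the sake of [join_mult]. *)
Lemma concat_same_rank a b lo h l hi (xv xw : int -> G) wv ww t :
  rpred a = Some b -> can_glue b ->
  wk (WalkS a lo (Some h) xv wv) -> wk (WalkS a (Some l) hi xw ww) ->
  embraces t (xv h) -> embraces t (xw l) ->
  exists (e f : int) p, let Z := join_walk a lo hi xv xw wv ww e f p in
  [/\ wk Z, same_tail (WalkS a (Some l) hi xw ww) Z,
      same_tail (wrev (WalkS a lo (Some h) xv wv)) (wrev Z),
      (e = h \/ e = h + 1) /\ (f = l \/ f = l + 1)
    & is_walk p /\ rlt (wrank p) a].
Proof.
move=> ab glue wV wW tv tw.
have ra : rpred a <> None by rewrite ab.
have := wV; rewrite (walk_within_succ _ _ _ _ _ _ ra) => -[exv v1 v2 [_ v3 v4 v5 v6]].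
have := wW; rewrite (walk_within_succ _ _ _ _ _ _ ra) => -[exw w1 w2 [_ w3 w4 w5 w6]].
have al : above lo (h - 1).
  by case: exv => m /andP[] /=; case: (lo) => //= i; lia.
have bh : below hi (l + 1).
  by case: exw => m /andP[] /=; case: (hi) => //= i; lia.
have al0 : above lo h by case: (lo) al => //= i; lia.
have bh0 : below hi l by case: (hi) bh => //= i; lia.
have pv : piece_pos lo (Some h) (h - 1) by rewrite /piece_pos al /=; lia.
have pw : piece_pos (Some l) hi l by rewrite /piece_pos bh /= lexx.
have [rv lv rrv] := v5 _ pv; have [rw lw rrw] := w5 _ pw.
rewrite subrK in rrv.
have rxv : rle (nrank (xv h)) a by apply: v3; rewrite /node_pos al0 /=.
have rxw : rle (nrank (xw l)) a by apply: w3; rewrite /node_pos bh0 /= lexx.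
have iv : above lo (h - 2) -> interior_pos lo (Some h) (h - 1).
  move=> al2; have e2 : h - 1 - 1 = h - 2 :> int by clear; lia.
  by rewrite /interior_pos e2 al2 /= subrK lexx.
have iw : below hi (l + 1 + 1) -> interior_pos (Some l) hi (l + 1).
  by move=> bh2; rewrite /interior_pos bh2 /= addrK lexx.
have e2 : h - 1 - 1 = h - 2 :> int by clear; lia.
have e3 : h + 1 - 2 = h - 1 :> int by clear; lia.
(* The first walk arrives through a wtip of rank a - 1: keep all of it, and let
   p be the first piece of the second walk. *)
have [[rb ib]|ntv] := pselect (wrank (wv (h - 1)) = b /\ whi (wv (h - 1)) = None).
  have [u xu ru] := tip_reaches_rank hG (conj ib rrv).
  rewrite rb in ru; have {}ru := rpred_inj ru ab.
  have ee : xv h = u by apply: (embraces_eq hG xu); rewrite ru.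
  have ry : nrank (xv h) = a by rewrite ee.
  have yy' := embraces_of_top_rank tv tw ry rxw.
  exists (h + 1), (l + 1), (ww l).
  have [||||||Z1 Z2 Z3] := join_within (e := h + 1) (f := l + 1) ra _ _ wV wW (w1 _ pw) rw.
  - by right.
  - by right.
  - by rewrite addrK; exact: reaches_left_mono lw.
  - by [].
  - by rewrite addrK e3 => _; split=> //; left; rewrite rb.
  - by move=> /iw hh; split; [exact: w4|have := w6 _ hh; rewrite addrK].
  by split=> //; [split; right|split=> //; case: (w1 _ pw)].
(* Mirror image: keep all of the second walk. *)
have [[rb ib]|ntw] := pselect (wrank (ww l) = b /\ wlo (ww l) = None).
  have [|u xu ru] := tip_reaches_rank hG (W := wrev (ww l)) (x := xw l).
    by apply/tip_reaches_right_rev.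
  rewrite wrank_rev rb in ru; have {}ru := rpred_inj ru ab.
  have ee : xw l = u by apply: (embraces_eq hG xu); rewrite ru.
  have ry : nrank (xw l) = a by rewrite ee.
  have yy' := embraces_of_top_rank tw tv ry rxv.
  exists h, l, (wv (h - 1)).
  have [||||||Z1 Z2 Z3] := join_within (e := h) (f := l) ra _ _ wV wW (v1 _ pv) rv.
  - by left.
  - by left.
  - by [].
  - exact: reaches_right_mono rrv.
  - by move=> /iv hh; split; [exact: v4|have := v6 _ hh; rewrite e2].
  - by move=> _; split=> //; right; rewrite rb.
  by split=> //; [split; left|split=> //; case: (v1 _ pv)].
(* Neither does: both adjacent pieces are replaced by a single one. *)
have [||||||||p [p1 p2 p3 p4]] := glue (wv (h - 1)) (ww l) t (v1 _ pv) (w1 _ pw).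
- by rewrite -(rlt_pred _ ab).
- by rewrite -(rlt_pred _ ab).
- by move=> ib; move: rv; rewrite (rlt_pred _ ab) => /rle_eqVlt[rb|//]; case: ntv.
- by move=> ib; move: rw; rewrite (rlt_pred _ ab) => /rle_eqVlt[rb|//]; case: ntw.
- exact: reaches_right_mono rrv.
- exact: reaches_left_mono lw.
- by exists (xv (h - 1)).
- by exists (xw (l + 1)).
have rp : rlt (wrank p) a by rewrite (rlt_pred _ ab).
exists h, (l + 1), p.
have [||||||Z1 Z2 Z3] := join_within (e := h) (f := l + 1) ra _ _ wV wW p1 rp.
- by left.
- by right.
- exact: p3.1.
- exact: p4.1.
- move=> /iv hh; split; first exact: v4.
  have := v6 _ hh; rewrite e2 => -[h1|[h1 h2]]; [by left|right].
  move: h1; rewrite ab => -[h1].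
  have [||r' t''] := keeps_tip (x := xv (h - 1)) p3; first by rewrite wrank_rev.
    by apply/tip_reaches_right_rev.
  by rewrite -(wrank_rev p) r'; split=> //; apply/tip_reaches_right_rev.
- move=> /iw hh; split; first exact: w4.
  have := w6 _ hh; rewrite addrK => -[[h1 h2]|h1]; [left|by right].
  move: h1; rewrite ab => -[h1].
  by have [||r' t''] := keeps_tip (x := xw (l + 1)) p4; rewrite ?r'.
by split=> //; [split; [left|right]|case: p1].
Qed.

Lemma to_rank a V t x0 : rpred a <> None -> rle a rho -> wk V ->
  rle (wrank V) a -> whi V <> None -> reaches_left V x0 -> reaches_right V t ->
  exists lo h xv wv, let V' := WalkS a lo (Some h) xv wv in
    [/\ wk V', embraces t (xv h) & keeps_left a V V'].
Proof.
move=> ra ar wV /rle_eqVlt[rV|lt] iV lx rt.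
  case: V wV rV iV lx rt => [lo hi x|a' lo hi x w] wV rV iV lx rt.
    by case: ra; rewrite -rV.
  move: rV => /= rV; subst a'; case: hi iV wV rt lx => [h|//] _ wV rt lx.
  by exists lo, h, x, w; split=> //; exact: keeps_right_refl.
have [u [v [h1 h2 h3 _ _]]] := lift_walk hG tip_closed wV lt ra ar lx rt.
exists (Some 0), 1, (fun m => if m <= 0 then u else v), (fun=> V).
split=> //; first exact: (h3 _ rt).
by apply: keeps_right_lt; rewrite ?wrank_rev.
Qed.

(** If one of the walks has rank less than a, it enters as a walk of rank a with a
    single piece, so that [concat_same_rank] applies. *)
Lemma concat_succ a b : rpred a = Some b -> rle a rho -> can_glue b -> can_concat a.
Proof.
move=> ab ar glue V W t wV wW lV lW fV fW rV rW [x xV] [z zW].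
have ra : rpred a <> None by rewrite ab.
have [lo [h [xv [wv [v1 v2 v3]]]]] := to_rank ra ar wV lV fV xV rV.
have [||||hi [l [xw' [ww' [w1 w2 w3]]]]] := @to_rank a (wrev W) t z ra ar (walk_within_rev wW).
- by rewrite wrank_rev.
- by rewrite whi_rev; case: (wlo W) fW.
- by rewrite reaches_left_rev.
- by [].
have [|e [f [p [Z1 Z2 Z3 _ _]]]] :=
  concat_same_rank ab glue v1 (walk_within_rev w1) v2 (t := t).
  by rewrite opprK.
have wZ : is_walk (join_walk a lo (omap -%R hi) xv (fun m => xw' (- m)) wv
    (fun m => wrev (ww' (- m - 1))) e f p) by case: Z1.
eexists; split; first exact: Z1.
- exact: rle_refl.
- apply: keeps_right_trans v3 _; apply: same_tail_keeps Z3; exact: is_walk_rev.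
- have := same_tail_keeps a wZ Z2; apply: keeps_right_trans.
  by move: w3; rewrite /keeps_left wrevK.
Qed.

Lemma concat_fin0 : can_concat (Fin 0).
Proof.
move=> V W t wV wW lV lW fV fW rV rW _ _.
case: V wV lV fV rV => [lo hi xv|a lo hi xv wv] wV lV fV rV; last first.
  by move: lV wV {fV rV}; case: a => [[|n]||] // _ [[_ _ []]].
case: W wW lW fW rW => [lo' hi' xw|a lo' hi' xw ww] wW lW fW rW; last first.
  by move: lW wW {fW rW}; case: a => [[|n]||] // _ [[_ _ []]].
case: hi fV rV wV {lV} => [h|//] _ rV wV.
case: lo' fW rW wW {lW} => [l|//] _ rW wW.
move: rW; rewrite (@reaches_left_fin _ _ l) // => rW.
have [Z1 Z2 Z3] := concat_zero wV wW rV rW.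
eexists; split; first exact: Z1.
- by [].
- by apply: same_tail_keeps Z3; apply: is_walk_rev; case: Z1.
- by apply: same_tail_keeps Z2; case: Z1.
Qed.

Lemma concat_fin n : rle (Fin n) rho -> can_concat (Fin n).
Proof.
elim: n => [|n IHn] le; first exact: concat_fin0.
apply: (@concat_succ _ (Fin n)) => //.
have le' : rle (Fin n) rho by apply: rle_trans le; rewrite /rle /= -leqNgt.
by apply: glue_of_concat => //; exact: IHn.
Qed.

Lemma glue_fin n : rle (Fin n) rho -> can_glue (Fin n).
Proof. by move=> le; apply: glue_of_concat => //; exact: concat_fin. Qed.

(** The condition on the piece m of an arrow-walk to the right of its centre. *)
Definition arrow_step (xw : int -> G) (ww : int -> walk G) m : Prop :=
  [/\ rlt (nrank (xw m)) (nrank (xw (m + 1))),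
      rlt (nrank (xw (m + 1))) Arrow,
      rpred (nrank (xw (m + 1))) = Some (wrank (ww m)),
      reaches_left (ww m) (xw m) & tip_reaches_right (ww m) (xw (m + 1))].

Lemma arrow_right_facts l hi (xw : int -> G) ww :
  wk (WalkS Arrow (Some l) hi xw ww) ->
  [/\ hi = None, forall m : int, l <= m -> arrow_step xw ww m,
      forall m : int, l <= m -> wk (ww m) & forall m : int, l <= m -> M (xw m)].
Proof.
move=> [[_ h2 [h0 [c [/= hc _ h3 _]]]] hB hM].
have hi0 : hi = None by case: h0.
have pm m : l <= m -> piece_pos (Some l) hi m by rewrite hi0 /piece_pos /= andbT.
split=> //.
- by move=> m lm; apply: h3; [exact: pm|rewrite -hc].
- move=> m lm; split; first by apply: h2; exact: pm.
    by move=> b hb; apply: hB; exists m => //; exact: pm.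
  by move=> b hb; apply: hM; right; exists m => //; exact: pm.
- move=> m lm; apply: hM; left; exists m => //.
  by rewrite hi0 /node_pos /= andbT.
Qed.

Hypothesis arrow_rho : rle Arrow rho.

Lemma fin_rho n : rle (Fin n) rho.
Proof. by apply: rle_trans arrow_rho. Qed.

Lemma tip_left_rank W x : reaches_left W x -> wlo W = None ->
  exists2 r, rpred r = Some (wrank W) & rle r (nrank x).
Proof.
move=> lx iW; have [|u xu ru] := tip_reaches_rank hG (W := wrev W) (x := x).
  by split=> //; rewrite whi_rev iW.
by exists (nrank u); [rewrite ru wrank_rev|exact: (embraces_rle hG)].
Qed.

(** Gluing its first k + 1 pieces turns the beginning of an arrow-walk into one
    walk of natural rank.  It still arrives through a wtip of the rank required
    by the next wnode, and k can be taken so large that this rank exceeds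
    any given natural number. *)
Lemma arrow_initial l hi (xw : int -> G) ww k :
  wk (WalkS Arrow (Some l) hi xw ww) ->
  exists I n, [/\ wk I, nrank (xw (l + k.+1%:Z)) = Fin n.+1 /\ (k <= n)%N,
    wrank I = Fin n /\ tip_reaches_right I (xw (l + k.+1%:Z)),
    reaches_left I (xw l) & rlt (nrank (xw l)) (Fin n.+1)].
Proof.
move=> /arrow_right_facts[_ steps wks _].
have step_rank m : l <= m -> exists n, nrank (xw (m + 1)) = Fin n.+1 /\ wrank (ww m) = Fin n.
  move=> /steps[_ lt rp _ _]; move: lt rp.
  by case: (nrank _) => [[|n]||] // _ [<-]; exists n.
elim: k => [|k [I [n [wI [rx kn] [rI tI] lI lt]]]].
  have [n [rx rw]] := step_rank l (lexx _); have [s1 _ _ s4 s5] := steps l (lexx _).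
  by exists (ww l), n; split=> //; [exact: wks|rewrite -rx].
set m := l + k.+1%:Z in rx tI *.
have lm : l <= m by rewrite /m; clear; lia.
have -> : l + k.+2%:Z = m + 1 by rewrite /m; clear; lia.
have [n' [rx' rw]] := step_rank m lm; have [s1 _ _ s4 s5] := steps m lm.
have nn' : (n < n')%N by move: s1; rewrite rx rx' /=.
have [||||||||Z [z1 z2 z3 z4]] := glue_fin (fin_rho n') (V := I) (W := ww m) (t := xw m) wI (wks _ lm).
- by rewrite rI /rle /= -leqNgt ltnW.
- by rewrite rw; exact: rle_refl.
- by rewrite rI.
- move=> iw; have [r] := tip_left_rank s4 iw.
  by rewrite rw rx => /rpred_Fin->; rewrite /rle /= ltnS nn'.
- by case: tI.
- by [].
- by exists (xw l).
- by exists (xw (m + 1)); case: s5.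
have [rZ tZ] := keeps_tip z4 rw s5.
exists Z, n'; split=> //.
- by split=> //; exact: leq_ltn_trans kn nn'.
- exact: z3.1.
- by apply: rlt_le_trans lt _; rewrite /rle /= -leqNgt ltnS ltnW.
Qed.

(** A walk of natural rank is absorbed by the beginning of the arrow-walk: far
    enough along the latter, the ranks exceed everything in the former. *)
Lemma concat_nat_arrow m V W t x : wrank V = Fin m -> wrank W = Arrow ->
  wk V -> wk W -> whi V <> None -> wlo W <> None ->
  reaches_right V t -> reaches_left W t -> reaches_left V x ->
  has_concat Arrow V W.
Proof.
move=> rV rW wV wW fV fW tV tW lV.
case: W rW wW fW tW => [//|a lo hi xw ww] /= ->{a}; case: lo => [l|//] wW _ tW.
move: tW; rewrite (@reaches_left_fin _ _ l) // => tW.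
have [hi0 steps wks nds] := arrow_right_facts wW; subst hi.
have ltV : rlt (wrank (wrev V)) rho.
  by apply: rlt_le_trans arrow_rho; rewrite wrank_rev rV.
have [u [Nu lu umin ru]] := right_node hG tip_closed (walk_within_rev wV) lV
  (fun _ => ltV).
have {}ru : rle (nrank u) (Fin m.+1).
  case: ru => [[h iV ->]|[_]].
    have := terminal_rank (is_walk_rev (let: And3 wV1 _ _ := wV in wV1)) iV.
    by rewrite wrank_rev rV => /rle_trans; apply; rewrite /rle /= -leqNgt.
  by rewrite wrank_rev rV => /rpred_Fin->; exact: rle_refl.
have [I [n [wI [rx kn] [rI tI] lI lt]]] := arrow_initial m.+1 wW.
set f := l + _ in rx tI.
have lf : l <= f by rewrite /f; clear; lia.
have [||||||||Z0 [z1 z2 z3 z4]] := glue_fin (fin_rho n) (V := V) (W := I) (t := t) wV wI.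
- by rewrite rV /rle /= -leqNgt; apply: leq_trans kn; exact: leqnSn.
- by rewrite rI; exact: rle_refl.
- by rewrite rV /= kn.
- move=> iI; have [r] := tip_left_rank lI iI.
  by rewrite rI => /rpred_Fin->; rewrite /rle lt.
- by [].
- exact: reaches_left_mono lI.
- by exists x.
- by exists (xw f); case: tI.
have [rZ tZ] := keeps_tip z4 rI tI.
pose Z := join_walk Arrow (Some (-1)) None (fun=> u) xw (fun=> Z0) ww 0 f Z0.
have fm (i : int) : 0 <= i -> l <= i + f by move: lf; clear; lia.
have wZ : wk Z.
  split.
  - split.
    + by exists 0.
    + move=> i; rewrite /piece_pos above_shift => /andP[/= i1 _]; rewrite /join_pieces.
      case: ifP => // _; first by case: z1.
      case: eqP => // i2; first by case: z1.
      by case: (wks (i + f)) => //; apply: fm; move: i1 i2; clear; lia.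
    + split; first by right.
      exists (-1); split=> //.
        move=> i _ i1; rewrite /join_nodes /join_pieces [i < -1]ltNge i1 /=.
        have [->|i0] : i = -1 \/ 0 <= i by move: i1; clear; lia.
          rewrite /= add0r rx rZ; split=> //; last exact: z3.1.
          by apply: rle_lt_trans ru _; rewrite /= ltnS.
        rewrite !ifF; [|by move: i0; clear; lia..].
        have -> : i + 1 + f = i + f + 1 by clear; lia.
        by apply: steps; exact: fm.
      by move=> i; rewrite /piece_pos above_shift /= => /andP[i1 _]; move: i1; clear; lia.
  - apply: join_wbranches => //; [by case: z1..|].
    by move=> i fi _; case: (wks i) => //; exact: le_trans fi.
  - apply: join_wnodes => //; [by case: z1..| |].
      by move=> i fi _; apply: nds; exact: le_trans fi.
    by move=> i fi _; case: (wks i) => //; exact: le_trans fi.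
exists Z; split=> //.
- apply: keeps_right_lt; first by rewrite wrank_rev rV.
  move=> y /umin yu; rewrite -/(reaches_left Z y).
  by rewrite (@reaches_left_fin _ _ (-1)).
- by apply: same_tail_keeps; [case: wZ|apply: join_tail_right].
Qed.

(** The terminal wnode of the first walk becomes the centre of an endless
    arrow-walk, on condition that the next wnode has larger rank; the beginning of the
    second walk is therefore contracted to one piece. *)
Lemma concat_arrow_arrow l h lo hi (xv xw : int -> G) wv ww :
  wk (WalkS Arrow lo (Some h) xv wv) -> wk (WalkS Arrow (Some l) hi xw ww) ->
  embraces (xv h) (xw l) ->
  has_concat Arrow (WalkS Arrow lo (Some h) xv wv) (WalkS Arrow (Some l) hi xw ww).
Proof.
move=> wV wW yy'.
have [hi0 steps wks nds] := arrow_right_facts wW; subst hi.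
have := walk_within_rev wV => /= /arrow_right_facts[lo0 steps' wks' nds'].
have {lo0 wV} : lo = None by case: (lo) lo0.
move=> lo0; subst lo.
have {}steps' i : i < h ->
  [/\ rlt (nrank (xv (i + 1))) (nrank (xv i)), rlt (nrank (xv i)) Arrow,
      rpred (nrank (xv i)) = Some (wrank (wv i)), tip_reaches_left (wv i) (xv i)
    & reaches_right (wv i) (xv (i + 1))].
  move=> ih; have [|] := steps' (- (i + 1)); first by move: ih; clear; lia.
  have -> : - (- (i + 1) + 1) = i by clear; lia.
  have -> : - - (i + 1) - 1 = i by clear; lia.
  rewrite opprK wrank_rev reaches_left_rev => s1 s2 s3 s4 /tip_reaches_right_rev s5.
  by split.
have {}wks' i : i < h -> wk (wv i).
  move=> ih; have := wks' (- (i + 1)).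
  have -> : - - (i + 1) - 1 = i by clear; lia.
  by rewrite -{2}(wrevK (wv i)) => H; apply: walk_within_rev; apply: H; move: ih; clear; lia.
have {}nds' i : i <= h -> M (xv i).
  by move=> ih; rewrite -(opprK i); apply: nds'; move: ih; clear; lia.
have [r rr] : exists r, nrank (xv h) = Fin r.
  have [|s1 s2 _ _ _] := steps' (h - 1); first by clear; lia.
  rewrite subrK in s1; move: (rlt_le_trans s1 (rltW s2)).
  by case: (nrank _) => // n _; exists n.
have [I [n [wI [rx kn] [rI tI] lI lt]]] := arrow_initial r wW.
set f := l + _ in rx tI.
have lf : l <= f by rewrite /f; clear; lia.
have fm (i : int) : 0 <= i -> l <= i + f by move: lf; clear; lia.
have he (i : int) : i < -1 -> i + (h + 1) < h by clear; lia.
pose Z := join_walk Arrow None None xv xw wv ww (h + 1) f I.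
have wZ : wk Z.
  split.
  - split.
    + by exists 0.
    + move=> i _; rewrite /join_pieces.
      case: ifP => [/he/wks'[]//|i1]; case: eqP => i2; first by case: wI.
      by case: (wks (i + f)) => //; apply: fm; move: i1 i2; clear; lia.
    + split; first by right.
      exists (-1); split=> //.
        move=> i _ i1; rewrite /join_nodes /join_pieces [i < -1]ltNge i1 /=.
        have [->|i0] : i = -1 \/ 0 <= i by move: i1; clear; lia.
          have -> : -1 + (h + 1) = h by clear; lia.
          rewrite /= add0r rx rI rr; split=> //.
          exact: reaches_left_mono lI.
        rewrite !ifF; [|by move: i0; clear; lia..].
        have -> : i + 1 + f = i + f + 1 by clear; lia.
        by apply: steps; exact: fm.
      move=> i _ i1; rewrite /join_nodes /join_pieces !ifT; [|by move: i1; clear; lia..].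
      have -> : i + 1 + (h + 1) = i + (h + 1) + 1 by clear; lia.
      by apply: steps'; exact: he.
  - apply: join_wbranches => //; [|by case: wI|].
      move=> i _ ih; case: (wks' i) => //; move: ih; clear; lia.
    by move=> i fi _; case: (wks i) => //; exact: le_trans fi.
  - apply: join_wnodes => //; [| |by case: wI| |].
    + by move=> i _ ih; apply: nds'; move: ih; clear; lia.
    + by move=> i _ ih; case: (wks' i) => //; move: ih; clear; lia.
    + by move=> i fi _; apply: nds; exact: le_trans fi.
    + by move=> i fi _; case: (wks i) => //; exact: le_trans fi.
exists Z; split=> //.
- apply: same_tail_keeps; first by apply: is_walk_rev; case: wZ.
  by apply: join_tail_left => //=; rewrite addrK.
- by apply: same_tail_keeps; [case: wZ|apply: join_tail_right].
Qed.

Lemma concat_arrow : can_concat Arrow.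
Proof.
move=> V W t wV wW lV lW fV fW rV rW [x xV] [z zW].
have arrow_or_fin r : rle r Arrow -> r = Arrow \/ exists m, r = Fin m.
  by case: r => [m||] // _; [right; exists m|left].
case: (arrow_or_fin _ lV) => [eV|[m eV]]; case: (arrow_or_fin _ lW) => [eW|[m' eW]].
- case: V eV wV lV fV rV xV => [//|a lo hi xv wv] /= ->{a}; case: hi => [h|//] wV _ _ rV xV.
  case: W eW wW lW fW rW zW => [//|a lo' hi' xw ww] /= ->{a}; case: lo' => [l|//] wW _ _ rW zW.
  move: rW; rewrite (@reaches_left_fin _ _ l) // => rW.
  case: (embraces_down_linear hG rV rW) => [|yy']; first exact: concat_arrow_arrow.
  apply: has_concat_rev; apply: concat_arrow_arrow; rewrite ?opprK //.
  - exact: walk_within_rev wW.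
  - exact: walk_within_rev wV.
- apply: has_concat_rev; apply: (@concat_nat_arrow m' _ _ t z).
  + by rewrite wrank_rev.
  + by rewrite wrank_rev.
  + exact: walk_within_rev.
  + exact: walk_within_rev.
  + by rewrite whi_rev; case: (wlo W) fW.
  + by rewrite wlo_rev; case: (whi V) fV.
  + by [].
  + by rewrite reaches_left_rev.
  + by rewrite reaches_left_rev.
- exact: concat_nat_arrow eV eW wV wW fV fW rV rW xV.
- have [||||||||Z [h1 h2 h3 h4]] := @concat_fin (maxn m m') (fin_rho _) V W t wV wW.
  + by rewrite eV /rle /= -leqNgt leq_maxl.
  + by rewrite eW /rle /= -leqNgt leq_maxr.
  + by [].
  + by [].
  + by [].
  + by [].
  + by exists x.
  + by exists z.
  exists Z; split=> //; first by apply: rle_trans h2 _.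
    by apply: keeps_right_lt; rewrite ?wrank_rev ?eV //; exact: h3.1.
  by apply: keeps_right_lt; rewrite ?eW //; exact: h4.1.
Qed.

Lemma glue_arrow : can_glue Arrow.
Proof. by apply: glue_of_concat => //; exact: concat_arrow. Qed.

End Concat.

(** * Lengths of walks *)

Lemma below_next_le r s a : r <> Arrow -> s <> Arrow -> rle r s -> below_next r a ->
  [/\ below_next s a, (mult s a <= mult r a)%N & rlt r s -> mult s a = 0%N].
Proof.
case: r s => [k||] [j||] //= _ _; rewrite /rle /=.
- rewrite -leqNgt leq_eqVlt => /orP[/eqP->|kj] [a0 ha].
    by split=> //; rewrite ltnn.
  rewrite /mult ha //; split=> //; split=> // i ji; apply: ha; exact: ltn_trans ji.
- by move=> _ [a0 ha]; rewrite /mult a0 coef0; split=> // i _; rewrite coef0.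
Qed.

Lemma one_ended_length_rank a r : rlt a r -> r <> Arrow ->
  exists2 a', rpred a' = Some a & one_ended_length a = omega_pow_rank a' /\ a' <> Arrow.
Proof.
case: a r => [k||] [j||] //= _ _.
- by exists (Fin k.+1).
- by exists (Fin k.+1).
- by exists Omega.
Qed.

Section Lengths.
Variable G : prewgraph.
Implicit Types (x y u t : G) (W V Z : walk G).

Lemma one_ended_length_bound a r i : rlt a r -> r <> Arrow -> (i <= 2)%N ->
  below_next r (one_ended_length a *+ i) /\ (mult r (one_ended_length a *+ i) <= 2)%N.
Proof.
move=> lt rA i2; have [a' aa' [-> aA]] := one_ended_length_rank lt rA.
have b := below_nextMn i (below_next_omega_pow_rank a').
have [h1 h2 _] := below_next_le aA rA (rpred_le aa' lt) b.
split=> //; apply: leq_trans h2 _.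
by rewrite multMn mult_omega_pow_rank mul1n.
Qed.

Lemma two_ended_not_arrow W : is_walk W -> two_ended W -> wrank W <> Arrow.
Proof.
case: W => [//|a lo hi x w] /= [_ _ h] [/= hl hh] e; rewrite e in h.
by case: h => -[].
Qed.

(** By induction on the walk: an infinite walk of rank less than r has length at most
    omega^r . 2, and a two-ended walk of rank a has as length a finite sum of lengths
    of walks of rank less than a, so it stays below omega^(a + 1). *)
Lemma length_bounds W : is_walk W -> forall r, r <> Arrow ->
  (two_ended W -> rle (wrank W) r -> below_next r (wlength W)) /\
  (rlt (wrank W) r -> [/\ below_next r (wlength W), (mult r (wlength W) <= 2)%N
                       & two_ended W -> mult r (wlength W) = 0%N]).
Proof.
elim: W => [lo hi x|a lo hi x w IH] wW r rA.
  have b0 l h : wlength (Walk0 (Some l) (Some h) x) = omega_pow_rank (Fin 0) *+ absz (h - l)%R by [].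
  split.
    move=> []; case: lo hi wW => [l|//] [h|//] wW _ _ le; rewrite b0.
    have b := below_nextMn (absz (h - l)%R) (below_next_omega_pow_rank (Fin 0)).
    by have [] := below_next_le _ rA le b.
  move=> lt; case: lo hi wW lt => [l|] [h|] wW lt /=.
  - have b := below_nextMn (absz (h - l)%R) (below_next_omega_pow_rank (Fin 0)).
    by have [//|h1 h2 h3] := below_next_le _ rA (rltW lt) b; rewrite h3.
  - by have [h1 h2] := @one_ended_length_bound _ _ 1 lt rA isT; split=> // -[].
  - by have [h1 h2] := @one_ended_length_bound _ _ 1 lt rA isT; split=> // -[].
  - by have [h1 h2] := @one_ended_length_bound _ _ 2 lt rA isT; split=> // -[].
have two l h : lo = Some l -> hi = Some h ->
    a <> Arrow /\ below_next a (wlength (WalkS a lo hi x w)).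
  move=> el eh; have aA : a <> Arrow.
    by apply: (two_ended_not_arrow wW); rewrite /two_ended /= el eh.
  split=> //; rewrite el eh /=; apply: below_next_sum => i.
  have := wW; rewrite (is_walk_succ _ _ _ _ (rank_not_arrow_pred wW aA)) => -[[m0 pm0] ws [_ _ _ pc _]].
  have pp : piece_pos lo hi (l + (i : nat)%:Z).
    move: pm0; rewrite el eh /piece_pos /= => /andP[].
    by case: (i) => k /=; clear; lia.
  have [lt _ _] := pc _ pp.
  by have [_ /(_ lt)[]] := IH _ (ws _ pp) a aA.
split.
  move=> []; case el: lo => [l|//]; case eh: hi => [h|//] _ _ /= le.
  by have [aA b] := two _ _ el eh; rewrite el eh in b; have [] := below_next_le aA rA le b.
move=> lt; case el: lo => [l|]; case eh : hi => [h|].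
- have [aA b] := two _ _ el eh; rewrite el eh in b.
  by have [h1 h2 h3] := below_next_le aA rA (rltW lt) b; rewrite h3.
- by have [h1 h2] := @one_ended_length_bound _ _ 1 lt rA isT; split=> // -[].
- by have [h1 h2] := @one_ended_length_bound _ _ 1 lt rA isT; split=> // -[].
- by have [h1 h2] := @one_ended_length_bound _ _ 2 lt rA isT; split=> // -[].
Qed.

Lemma wlength_rev W : is_walk W -> wlength (wrev W) = wlength W.
Proof.
elim: W => [lo hi x|a lo hi x w IH] wW /=.
  by case: lo hi {wW} => [l|] [h|] //=; congr (_ *+ absz _); lia.
case: lo hi wW => [l|] [h|] //= [[m0 /andP[/= m1 m2]] ws _].
have lh : l < h by move: m1 m2; clear; lia.
rewrite (reindex_inj rev_ord_inj) /=.
have e : absz (- l - - h)%R = absz (h - l)%R by clear; lia.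
rewrite e; apply: eq_bigr => -[i lti] _ /=.
have -> : - (- h + (absz (h - l)%R - i.+1)%N%:Z) - 1 = l + i%:Z.
  by move: lh lti; clear; lia.
by rewrite IH //; apply: ws; rewrite /piece_pos /=; move: lh lti; clear; lia.
Qed.

End Lengths.

(** * Walks and nearness in a wsection *)

Lemma wbranches_branch (G : prewgraph) (W : walk G) : is_walk W -> wbranches W `<=` branch.
Proof.
elim: W => [lo hi x|a lo hi x w IH] /= [_ h1 h2] b [m pm].
  by move=> ->; exact: h2.
by apply: IH; exact: h1.
Qed.

(** The closure properties of a wsection on which the argument rests.  For
    rho = omega the wsection is the whole wgraph, and there only can incomparable
    wnodes embrace a common one, so only there loops have to be built out of
    arbitrary branches. *)
Record section_like (G : prewgraph) (rho : rank) (S : wsubgraph G) : Prop := {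
  sl_arrow : rho <> Arrow;
  sl_rank : srank S = rho;
  sl_node_rank : forall x, snode S x -> rle (nrank x) rho;
  sl_tip : forall W x, wtip_in W x -> wbranches W `<=` sbranch S ->
    rle (nrank x) rho -> snode S x;
  sl_conn : wconnected S;
  sl_Omega : rho = Omega -> branch `<=` sbranch S /\ forall x, snode S x }.

Lemma wsection_section_like (G : prewgraph) (nu rho : rank) (S : wsubgraph G) :
  rho <> Arrow -> rle rho nu -> is_wgraph G nu -> wconnected (whole G nu) ->
  is_wsection nu rho S -> section_like rho S.
Proof.
move=> rA rn hG conn [[e ->]|[ne [B [-> Bb cB _]]]].
  subst nu; split=> //=; first by move=> x _; exact: wg_rank hG x.
  by move=> _; split.
split=> //=; first by move=> x [].
  by move=> W x tW WB rx; split=> //; right; exists W.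
by move=> e; case: ne; move: rn; rewrite e; case: (nu).
Qed.


Lemma mult_Walk0 (N : Type) (l h : int) (x : int -> N) :
  mult (Fin 0) (wlength (Walk0 (Some l) (Some h) x)) = absz (h - l)%R.
Proof.
rewrite -[wlength _]/(omega_pow_rank (Fin 0) *+ absz (h - l)%R).
by rewrite multMn mult_omega_pow_rank mul1n.
Qed.

Section Distance.
Variables (G : prewgraph) (nu rho : rank) (S : wsubgraph G).
Hypotheses (hG : is_wgraph G nu) (hS : section_like rho S).
Implicit Types (x y z u t : G) (W V Z : walk G).
Local Notation wk := (walk_within (sbranch S) (snode S)).
Let tc := sl_tip hS.

Lemma walk_inE W : walk_in S W <-> wk W /\ rle (wrank W) rho.
Proof.
by rewrite /walk_in (sl_rank hS); split=> [[? ? ? ?]|[[? ? ?] ?]].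
Qed.

Lemma dist_bound W : wk W -> two_ended W -> rle (wrank W) rho ->
  below_next rho (wlength W).
Proof. by move=> [wW _ _] tW; exact: (length_bounds wW (sl_arrow hS)).1. Qed.

Lemma terminal_left_rank W l : is_walk W -> wlo W = Some l ->
  rle (nrank (wnode W l)) (wrank W).
Proof.
move=> wW e; have := @terminal_rank _ (wrev W) (- l) (is_walk_rev wW).
by rewrite whi_rev e wnode_rev opprK wrank_rev; apply.
Qed.

Lemma terminal_left_pos W l : is_walk W -> wlo W = Some l ->
  node_pos (wlo W) (whi W) l.
Proof.
move=> wW e; have := @terminal_pos _ (wrev W) (- l) (is_walk_rev wW).
rewrite whi_rev wlo_rev e => /(_ erefl).
by rewrite node_pos_rev opprK.
Qed.

(** Unlike [lift_walk], this keeps the terminal wnodes. *)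
Lemma raise_to_top_rank W l h : rpred rho <> None -> wk W -> rle (wrank W) rho ->
  wlo W = Some l -> whi W = Some h ->
  exists l' h' (xs : int -> G) ws, let V := WalkS rho (Some l') (Some h') xs ws in
    [/\ wk V, xs l' = wnode W l, xs h' = wnode W h &
      (mult rho (wlength V) <= mult rho (wlength W))%N].
Proof.
move=> ra wW /rle_eqVlt[rW|lt] el eh.
  case: W wW rW el eh => [lo hi x|a lo hi x w] wW rW.
    by case: ra; rewrite -rW.
  move: rW wW => /= -> wW el eh; rewrite el eh in wW *.
  by exists l, h, x, w.
have [w1 _ _] := wW.
exists 0, 1, (fun m => if m <= 0 then wnode W l else wnode W h), (fun=> W); split.
- apply: walk_within_wrap => //.
  + by rewrite (reaches_left_fin _ el); exact: embraces_refl.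
  + by rewrite (reaches_right_fin _ eh); exact: embraces_refl.
  + by apply: walk_within_node wW _; exact: terminal_left_pos.
  + by apply: walk_within_node wW _; exact: terminal_pos.
  + exact: rle_trans (terminal_left_rank w1 el) (rltW lt).
  + exact: rle_trans (terminal_rank w1 eh) (rltW lt).
- by [].
- by [].
- by rewrite /= big_ord1.
Qed.

(** Here x and y are the terminal wnodes themselves, whereas [joins] identifies
    undistinguished wnodes; concatenation needs the former. *)
Definition walk_from_to k x y : Prop := exists W l h,
  [/\ walk_in S W, wlo W = Some l /\ wnode W l = x, whi W = Some h /\ wnode W h = y
    & (mult rho (wlength W) <= k)%N].

Lemma can_glue_pred b : rpred rho = Some b ->
  can_glue (sbranch S) (snode S) b.
Proof.
case e: rho => [[|n]||] //= [<-].
- by apply: (glue_fin hG tc); rewrite e /rle /= -leqNgt.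
- by apply: (glue_arrow hG tc); rewrite e.
Qed.

(** The extra 2 is the largest coefficient of a walk of rank less than rho, hence of
    the piece inserted at the junction. *)
Lemma walk_from_to_trans k j x q r z t :
  walk_from_to k x q -> embraces t q -> embraces t r -> walk_from_to j r z ->
  walk_from_to (k + j + 2) x z.
Proof.
move=> [V [l0 [h [/walk_inE[wV rV] [elV <-] [ehV <-] kV]]]] tq tr.
move=> [W [l [h0 [/walk_inE[wW rW] [elW eW] [ehW <-] kW]]]].
subst r; case erho : (rpred rho) => [b|]; last first.
  have r0 : rho = Fin 0 by case: (rho) (sl_arrow hS) erho => [[|n]||].
  rewrite r0 in rV rW kV kW.
  case: V wV elV ehV rV tq kV => [lo hi xv|a lo hi xv wv] wV elV ehV rV tq kV; last first.
    by case: wV rV {elV ehV tq kV} => + _ _; case: a => [[|n]||] // [_ _ []].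
  case: W wW elW ehW rW tr kW => [lo' hi' xw|a lo' hi' xw ww] wW elW ehW rW tr kW; last first.
    by case: wW rW {elW ehW tr kW} => + _ _; case: a => [[|n]||] // [_ _ []].
  rewrite /= in elV ehV elW ehW tq tr; subst lo hi lo' hi'.
  have [Z1 _ _] := concat_zero hG wV wW tq tr.
  have lh : l0 < h by case: wV => -[[m /andP[/= + +]] _ _] _ _; clear; lia.
  have lh' : l < h0 by case: wW => -[[m /andP[/= + +]] _ _] _ _; clear; lia.
  eexists; exists (l0 - h), (h0 - l); split.
  - by apply/walk_inE; split; [exact: Z1|rewrite r0].
  - split=> //=; rewrite /join_nodes ifT; last by move: lh; clear; lia.
    by congr xv; clear; lia.
  - split=> //=; rewrite /join_nodes ifF; last by move: lh'; clear; lia.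
    by congr xw; clear; lia.
  - move: kV kW; rewrite r0 !mult_Walk0.
    by move: lh lh'; clear; lia.
have ra : rpred rho <> None by rewrite erho.
have [l1 [h1 [xv [wv [v1 v2 v3 v4]]]]] := raise_to_top_rank ra wV rV elV ehV.
have [l2 [h2 [xw [ww [w1 w2 w3 w4]]]]] := raise_to_top_rank ra wW rW elW ehW.
rewrite -v3 in tq; rewrite -w2 in tr.
have [e [f [p [Z1 Z2 Z3 [he hf] [wp rp]]]]] :=
  concat_same_rank hG erho (can_glue_pred erho) v1 w1 tq tr.
have lh : l1 <= h1 - 1 by case: v1 => -[[m /andP[/= + +]] _ _] _ _; clear; lia.
have lh' : l2 + 1 <= h2 by case: w1 => -[[m /andP[/= + +]] _ _] _ _; clear; lia.
eexists; exists (l1 - e), (h2 - f); split.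
- by apply/walk_inE; split; [exact: Z1|exact: rle_refl].
- split=> //=; rewrite /join_nodes ifT; last by move: lh he; clear; lia.
  by rewrite subrK v2.
- split=> //=; rewrite /join_nodes ifF; last by move: lh' hf; clear; lia.
  by rewrite subrK w3.
- apply: leq_trans (join_mult rho rho xv xw wv ww p lh lh' he hf) _.
  have [_ /(_ rp)[_ p2 _]] := length_bounds wp (sl_arrow hS).
  by apply: leq_add => //; apply: leq_add; [exact: leq_trans kV|exact: leq_trans kW].
Qed.

Lemma walk_from_to_sym k x y : walk_from_to k x y -> walk_from_to k y x.
Proof.
move=> [W [l [h [/walk_inE[wW rW] [el xl] [eh yh] kW]]]].
exists (wrev W), (- h), (- l); split.
- by apply/walk_inE; rewrite wrank_rev; split=> //; exact: walk_within_rev.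
- by rewrite wlo_rev eh wnode_rev opprK.
- by rewrite whi_rev el wnode_rev opprK.
- by rewrite wlength_rev //; case: wW.
Qed.

(** If x and z are incomparable above y, they embrace a wnode t of positive natural
    rank.  A representative of a wtip of t, run backwards and then forwards, leads
    from t to t, hence from x to z, within a natural rank. *)
Lemma undistinguished_or_loop x y z : snode S x -> snode S z ->
  undistinguished x y -> undistinguished y z ->
  undistinguished x z \/ walk_from_to 2 x z.
Proof.
move=> Nx Nz xy yz.
case: (undistinguished_trans_or hG xy yz) => [|[t [n [rt xt zt]]]]; first by left.
have [eO|nO] := pselect (rho = Omega); last first.
  left.
  have natr u : snode S u -> exists m, nrank u = Fin m.
    move=> /(sl_node_rank hS).
    move: nO (sl_arrow hS); case: (rho) => [k||] // _ _ /rle_Fin[m e _].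
    by exists m.
  have [m rm] := natr x Nx.
  exact: (embraces_up_linear_nat hG rm xt zt).
right.
have [allB allN] := sl_Omega hS eO.
have [|W tW] := wg_tip_nonempty hG (x := t); first by rewrite rt.
have [[wW fW iW] rW] := wg_tip_rank hG tW.
rewrite rt in rW; case: rW => rW.
have wk_all V : is_walk V -> wk V.
  by move=> wV; split=> //; apply: subset_trans allB; exact: wbranches_branch.
have arho : rle Arrow rho by rewrite eO.
case el : (wlo W) fW => [l|//] _.
have eW : from l W = W by case: (W) el => [lo hi ?|a lo hi ? ?] /= ->.
have rtW : reaches_right W t.
  rewrite /reaches_right iW; exists l, t; rewrite el /= lexx eW.
  by split=> //; exact: embraces_refl.
have [||||||||Z [z1 z2 z3 z4]] := concat_fin hG tc (fin_rho arho n) (V := wrev W) (W := W)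
  (t := wnode W l) (walk_within_rev (wk_all _ wW)) (wk_all _ wW).
- by rewrite wrank_rev -rW; exact: rle_refl.
- by rewrite -rW; exact: rle_refl.
- by rewrite whi_rev el.
- by rewrite el.
- by rewrite reaches_right_rev (reaches_left_fin _ el); exact: embraces_refl.
- by rewrite (reaches_left_fin _ el); exact: embraces_refl.
- by exists t; rewrite reaches_left_rev.
- by exists t.
have rZ : rlt (wrank Z) Omega by apply: rle_lt_trans z2 _.
exists (wrap Omega x z Z), 0, 1; split.
- apply/walk_inE; split; last by rewrite eO.
  apply: walk_within_wrap => //.
  + apply: (reaches_left_mono xt).
    by apply: z3.1; rewrite wrevK.
  + by apply: (reaches_right_mono zt); apply: z4.1.
- by [].
- by [].
- rewrite /= big_ord1.
  have wZ : is_walk Z by case: z1.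
  by have [_] := length_bounds wZ (sl_arrow hS); rewrite eO => /(_ rZ)[].
Qed.

Definition near k x y : Prop :=
  undistinguished x y \/
  exists2 W, walk_in S W & joins W x y /\ (mult rho (wlength W) <= k)%N.

Lemma joins_ends W x y : joins W x y -> exists l h,
  [/\ wlo W = Some l, whi W = Some h, undistinguished (wnode W l) x
    & undistinguished (wnode W h) y].
Proof.
by rewrite /joins; case: (wlo W) (whi W) => [l|] [h|] // [? ?]; exists l, h.
Qed.

Lemma near_ends k x y : near k x y -> undistinguished x y \/
  exists p q, [/\ walk_from_to k p q, undistinguished p x, undistinguished q y,
    snode S p & snode S q].
Proof.
case=> [|[W wW [/joins_ends[l [h [el eh ? ?]]] kW]]]; first by left.
right; exists (wnode W l), (wnode W h).
have [wk1 _] := (walk_inE W).1 wW.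
have [w1 _ _] := wk1.
split=> //.
- by exists W, l, h.
- by apply: walk_within_node wk1 _; exact: terminal_left_pos.
- by apply: walk_within_node wk1 _; exact: terminal_pos.
Qed.

Lemma near_of_ends k p q x y : walk_from_to k p q -> undistinguished p x ->
  undistinguished q y -> near k x y.
Proof.
move=> [W [l [h [wW [el <-] [eh <-] kW]]]] px qy; right; exists W => //.
by rewrite /joins el eh.
Qed.

Lemma near_sym k x y : near k x y -> near k y x.
Proof.
case/near_ends=> [/undistinguished_sym|[p [q [/walk_from_to_sym w px qy _ _]]]].
  by left.
exact: near_of_ends w qy px.
Qed.

Lemma near_le k j x y : (k <= j)%N -> near k x y -> near j x y.
Proof.
move=> kj [|[W h1 [h2 h3]]]; first by left.
by right; exists W => //; split=> //; exact: leq_trans kj.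
Qed.

Lemma undistinguished_top q y : undistinguished q y -> exists2 t, embraces t q & embraces t y.
Proof. by case=> h; [exists q|exists y] => //; exact: embraces_refl. Qed.

Lemma near_undistinguished_trans k x y z : snode S z -> near k x y -> undistinguished y z ->
  snode S x -> near (k + 4) x z.
Proof.
move=> Nz /near_ends[xy|[p [q [w px qy Np Nq]]]] yz Nx.
  case: (undistinguished_or_loop Nx Nz xy yz) => [|w]; first by left.
  apply: near_le (near_of_ends w (undistinguished_refl _) (undistinguished_refl _)).
  by rewrite addnC.
case: (undistinguished_or_loop Nq Nz qy yz) => [qz|w'].
  by apply: near_le (near_of_ends w px qz); exact: leq_addr.
apply: near_le (near_of_ends (walk_from_to_trans w _ _ w') px (undistinguished_refl _)).
- by rewrite -addnA.
- exact: embraces_refl.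
- exact: embraces_refl.
Qed.

(** The worst case is a walk to q, a loop from q to r and a walk from r, where q and r
    are incomparable: 2 for the loop and 2 for each of the two junctions. *)
Lemma near_trans k j x y z : snode S x -> snode S z ->
  near k x y -> near j y z -> near (k + j + 6) x z.
Proof.
move=> Nx Nz xy yz.
have := near_ends xy; case=> [uxy|[p [q [w px qy Np Nq]]]].
  have := near_undistinguished_trans Nx (near_sym yz) (undistinguished_sym uxy) Nz.
  by move=> /near_sym; apply: near_le; clear; lia.
have := near_ends yz; case=> [uyz|[r [s [w' ry sz Nr Ns]]]].
  by have := near_undistinguished_trans Nz xy uyz Nx; apply: near_le; clear; lia.
case: (undistinguished_or_loop Nq Nr qy (undistinguished_sym ry)) => [qr|w2].
  have [t tq tr] := undistinguished_top qr.
  apply: near_le (near_of_ends (walk_from_to_trans w tq tr w') px sz).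
  by clear; lia.
have w3 := walk_from_to_trans w (embraces_refl q) (embraces_refl q) w2.
have w4 := walk_from_to_trans w3 (embraces_refl r) (embraces_refl r) w'.
by apply: near_le (near_of_ends w4 px sz); clear; lia.
Qed.

End Distance.

(** * The coarse wdistance *)

(** The index is kept positive because a walk has to have at least one piece. *)
Lemma first_crossing (P : nat -> nat) n t : (0 < n)%N -> P 0%N = 0%N ->
  (forall j, (P j.+1 <= P j + 2)%N) -> (t <= P n)%N ->
  exists j, [/\ (0 < j)%N, (j <= n)%N, (t <= P j)%N & (P j <= t + 2)%N].
Proof.
move=> n0 P0 step tn.
have ex : exists j, (0 < j)%N && (t <= P j)%N by exists n; rewrite n0.
have [j /andP[j0 tj] jmin] := ex_minnP ex.
exists j; split=> //; first by apply: jmin; rewrite n0.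
case: j j0 tj jmin => [//|[|j]] _ tj jmin.
  by apply: leq_trans (step 0%N) _; rewrite P0 leq_add2r.
have : ~~ (t <= P j.+1)%N by apply/negP => h; have := jmin j.+1; rewrite h ltnn => /(_ isT).
have := step j.+1; clear; lia.
Qed.

Section CoarseDistance.
Variables (G : prewgraph) (nu rho : rank) (S : wsubgraph G).
Hypotheses (hG : is_wgraph G nu) (hS : section_like rho S).
Implicit Types (x y z u t : G) (W V Z : walk G).
Local Notation near := (near rho S).

Definition coarse x y : nat := mult rho (wdistance S x y).

Lemma lengths_below x y a : lengths_between S x y a -> below_next rho a.
Proof.
case=> [[_ ->]|[W [/(walk_inE hS)[wW rW] jW ->]]]; first exact: below_next0.
apply: (dist_bound hS) => //.
by have [l [h [el eh _ _]]] := joins_ends jW; rewrite /two_ended el eh.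
Qed.

Lemma wdistance_spec x y : snode S x -> snode S y ->
  lengths_between S x y (wdistance S x y) /\
  forall b, lengths_between S x y b -> ord_le (wdistance S x y) b.
Proof.
move=> Nx Ny.
have [W wW jW] := sl_conn hS Nx Ny.
have [|a La mina] := @ord_min (lengths_between S x y).
  by exists (wlength W); right; exists W.
have := @xgetPex _ 0 [set a | lengths_between S x y a /\
                  forall b, lengths_between S x y b -> ord_le a b].
by apply; exists a.
Qed.

Lemma wdistance_below x y : snode S x -> snode S y -> below_next rho (wdistance S x y).
Proof. by move=> Nx Ny; have [/lengths_below] := wdistance_spec Nx Ny. Qed.

Lemma near_coarse x y : snode S x -> snode S y -> near (coarse x y) x y.
Proof.
move=> Nx Ny; have [[[u _]|[W [wW jW e]]] _] := wdistance_spec Nx Ny; first by left.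
by right; exists W => //; split=> //; rewrite /coarse e.
Qed.

Lemma coarse_le k x y : snode S x -> snode S y -> near k x y -> (coarse x y <= k)%N.
Proof.
move=> Nx Ny nxy; have [L minL] := wdistance_spec Nx Ny.
have le a : lengths_between S x y a -> (coarse x y <= mult rho a)%N.
  by move=> La; apply: mult_le (lengths_below L) (lengths_below La) (minL _ La).
case: nxy => [u|[W wW [jW kW]]].
  by apply: leq_trans (le 0 _) _; [left|rewrite mult0].
by apply: leq_trans kW; apply: le; right; exists W.
Qed.

Lemma coarse_sym x y : snode S x -> snode S y -> coarse x y = coarse y x.
Proof.
by move=> Nx Ny; apply/eqP; rewrite eqn_leq; apply/andP; split;
  apply: coarse_le => //; apply: (near_sym hS); exact: near_coarse.
Qed.

Lemma coarse_refl x : snode S x -> coarse x x = 0%N.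
Proof.
move=> Nx; apply/eqP; rewrite -leqn0; apply: coarse_le => //.
by left; exact: undistinguished_refl.
Qed.

Lemma coarse_triangle x y z : snode S x -> snode S y -> snode S z ->
  (coarse x z <= coarse x y + coarse y z + 6)%N.
Proof.
move=> Nx Ny Nz; apply: coarse_le => //.
by apply: (near_trans hG hS) => //; exact: near_coarse.
Qed.

(** P j is the coefficient of the length of the first j pieces; cutting a walk of
    rank rho at an interior wnode leaves two walks of rank rho. *)
Lemma walk_cut W : walk_in S W -> two_ended W -> wrank W = rho ->
  exists n (P : nat -> nat), [/\ (0 < n)%N, P 0%N = 0%N, forall j, (P j.+1 <= P j + 2)%N,
    P n = mult rho (wlength W)
    & forall x y, joins W x y -> forall j, (0 < j)%N -> (j < n)%N ->
        exists u, [/\ snode S u, nrank u = rho, near (P j) x u & near (P n - P j) u y]].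
Proof.
move=> /(walk_inE hS)[wW _] tW rW.
have rA := sl_arrow hS.
case: W wW tW rW => [lo hi xs|a lo hi xs ws] wW [].
  case: lo wW => [l|//] wW _; case: hi wW => [h|//] wW _ r0'.
  have {r0'} r0 : Fin 0 = rho := r0'.
  have [[[m0 /andP[/= m1 m2]] w1 w2] w3 w4] := wW.
  exists (absz (h - l)%R), id; split=> //.
  - by move: m1 m2; clear; lia.
  - by move=> j; rewrite addn2.
  - by rewrite -r0 (mult_Walk0 l h xs).
  move=> x y [jx jy] j j0 jn; exists (xs (l + j%:Z)).
  have np : node_pos (Some l) (Some h) (l + j%:Z).
    by rewrite /node_pos /=; move: jn m1 m2; clear; lia.
  have ru := w1 _ np; split.
  - by apply: (walk_within_node wW np).
  - by rewrite ru -r0.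
  - right; exists (Walk0 (Some l) (Some (l + j%:Z)) xs); last split.
    + apply/(walk_inE hS); split; last by rewrite -r0.
      split; [split|..].
      * by exists l; rewrite /piece_pos /=; move: j0; clear; lia.
      * by move=> m /andP[/= h1 h2]; apply: w1; rewrite /node_pos /=; move: h1 h2 jn m1 m2; clear; lia.
      * by move=> m /andP[/= h1 h2]; apply: w2; rewrite /piece_pos /=; move: h1 h2 jn m1 m2; clear; lia.
      * move=> b [m /andP[/= h1 h2] ->]; apply: w3; exists m => //; rewrite /piece_pos /=; move: h1 h2 jn m1 m2; clear; lia.
      * move=> b [m /andP[/= h1 h2] ->]; apply: w4; exists m => //; rewrite /node_pos /=; move: h1 h2 jn m1 m2; clear; lia.
    + by split=> //; exact: undistinguished_refl.
    + by rewrite -r0 (mult_Walk0 l _ xs); clear; lia.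
  - right; exists (Walk0 (Some (l + j%:Z)) (Some h) xs); last split.
    + apply/(walk_inE hS); split; last by rewrite -r0.
      split; [split|..].
      * by exists (l + j%:Z); rewrite /piece_pos /=; move: jn m1 m2; clear; lia.
      * by move=> m /andP[/= h1 h2]; apply: w1; rewrite /node_pos /=; move: h1 h2 jn m1 m2; clear; lia.
      * by move=> m /andP[/= h1 h2]; apply: w2; rewrite /piece_pos /=; move: h1 h2 jn m1 m2; clear; lia.
      * move=> b [m /andP[/= h1 h2] ->]; apply: w3; exists m => //; rewrite /piece_pos /=; move: h1 h2 jn m1 m2; clear; lia.
      * move=> b [m /andP[/= h1 h2] ->]; apply: w4; exists m => //; rewrite /node_pos /=; move: h1 h2 jn m1 m2; clear; lia.
    + by split=> //; exact: undistinguished_refl.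
    + by rewrite -r0 (mult_Walk0 _ h xs) /=; move: jn m1 m2; clear; lia.
case: lo wW => [l|//] wW _; case: hi wW => [h|//] wW _ /= ra; subst a.
have w0 : is_walk (WalkS rho (Some l) (Some h) xs ws) by case: wW.
have rp := rank_not_arrow_pred w0 rA.
have [[m0 /andP[/= m1 m2]] pcs nds sw] := (walk_within_succ _ _ _ _ _ _ rp).1 wW.
pose g i := if (i < absz (h - l)%R)%N then mult rho (wlength (ws (l + i%:Z))) else 0%N.
have sub (l' h' : int) : l <= l' -> l' < h' -> h' <= h ->
    walk_in S (WalkS rho (Some l') (Some h') xs ws).
  move=> ll lh hh; apply/(walk_inE hS); split; last exact: rle_refl.
  apply/(walk_within_succ _ _ _ _ _ _ rp); split.
  - by exists l'; rewrite /piece_pos /=; move: lh; clear; lia.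
  - by move=> m /andP[/= h1 h2]; apply: pcs; rewrite /piece_pos /=; move: h1 h2 ll hh; clear; lia.
  - by move=> m /andP[/= h1 h2]; apply: nds; rewrite /node_pos /=; move: h1 h2 ll hh; clear; lia.
  - apply: successor_walk_sub sw => m /=; move: ll hh; clear; lia.
exists (absz (h - l)%R), (fun j => \sum_(i < j) g i)%N; split=> //.
- by move: m1 m2; clear; lia.
- by rewrite big_ord0.
- move=> j; rewrite big_ord_recr /= leq_add2l /g; case: ifP => // jl.
  have pp : piece_pos (Some l) (Some h) (l + j%:Z).
    by rewrite /piece_pos /=; move: jl m1 m2; clear; lia.
  have [_ _ _ /(_ _ pp)[lt _ _] _] := sw.
  have [wp _ _] := pcs _ pp.
  by have [_ /(_ lt)[]] := length_bounds wp rA.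
- rewrite /= mult_sum; apply: eq_bigr => -[i lti] _ /=.
  by rewrite /g lti.
move=> x y [jx jy] j j0 jn; exists (xs (l + j%:Z)).
have ip : interior_pos (Some l) (Some h) (l + j%:Z).
  by rewrite /interior_pos /=; move: j0 jn m1 m2; clear; lia.
split.
- by apply: nds; rewrite /node_pos /=; move: jn m1 m2; clear; lia.
- by case: sw => _ _ /(_ _ ip).
- right; exists (WalkS rho (Some l) (Some (l + j%:Z)) xs ws); last split.
  + by apply: sub; move: j0 jn m1 m2; clear; lia.
  + by split=> //; exact: undistinguished_refl.
  + rewrite /= mult_sum.
    have -> : absz (l + j%:Z - l)%R = j by clear; lia.
    rewrite leq_eqVlt; apply/orP; left; apply/eqP; apply: eq_bigr => -[i lti] _ /=.
    by rewrite /g (ltn_trans lti jn).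
- right; exists (WalkS rho (Some (l + j%:Z)) (Some h) xs ws); last split.
  + by apply: sub; move: j0 jn m1 m2; clear; lia.
  + by split=> //; exact: undistinguished_refl.
  + rewrite /= mult_sum.
    have e1 : absz (h - (l + j%:Z))%R = (absz (h - l)%R - j)%N by move: jn m1 m2; clear; lia.
    rewrite e1; move: (absz (h - l)%R) jn @g => n jn g.
    have split_sum a b : (\sum_(i < a + b) g i = \sum_(i < a) g i + \sum_(i < b) g (a + i))%N.
      by rewrite big_split_ord.
    have := split_sum j (n - j)%N; rewrite (subnKC (ltnW jn)) => ->; rewrite addKn.
    rewrite leq_eqVlt; apply/orP; left; apply/eqP; apply: eq_bigr => -[i lti] _ /=.
    rewrite /g ifT; first by congr (mult rho (wlength (ws _))); clear; lia.
    by move: lti; clear; lia.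
Qed.

(** Cut a shortest walk where the coefficient P j of its initial part first reaches
    t.  The coarse wdistance from x to the cut is at most P j; it is not much less, for
    otherwise the triangle inequality would give a shorter way to y.  If t is reached
    only at the end, y itself is a solution. *)
Lemma coarse_intermediate x y (t : nat) : snode S x -> snode S y -> nrank y = rho ->
  (t <= coarse x y)%N ->
  exists u, [/\ snode S u, nrank u = rho, (coarse x u <= t + 2)%N
    & (t <= coarse x u + 6)%N].
Proof.
move=> Nx Ny ry tK.
have triv : (coarse x y <= t + 2)%N -> exists u, [/\ snode S u, nrank u = rho,
    (coarse x u <= t + 2)%N & (t <= coarse x u + 6)%N].
  by move=> h; exists y; split=> //; apply: leq_trans tK (leq_addr _ _).
have [[[u e]|[W [wW jW e]]] _] := wdistance_spec Nx Ny.
  by apply: triv; rewrite /coarse e mult0.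
have tW : two_ended W.
  by have [l [h [el eh _ _]]] := joins_ends jW; rewrite /two_ended el eh.
have [[w1 w2 w3] rW] := (walk_inE hS W).1 wW.
case: (rle_eqVlt rW) => [{}rW|lt]; last first.
  apply: triv; rewrite /coarse e.
  by have [_ /(_ lt)[_ _ ->]] := length_bounds w1 (sl_arrow hS).
have [n [P [n0 P0 step Pn cut]]] := walk_cut wW tW rW.
rewrite /coarse e -Pn in tK triv.
have [j [j0 jn tj jt]] := first_crossing n0 P0 step tK.
move: jn; rewrite leq_eqVlt => /orP[/eqP ej|jn].
  by apply: triv; rewrite -ej.
have [u [Nu ru n1 n2]] := cut x y jW j j0 jn.
exists u; split=> //.
  by apply: leq_trans jt; exact: coarse_le.
have h1 := coarse_triangle Nx Nu Ny.
have h2 := coarse_le Nu Ny n2.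
have h3 : coarse x y = P n by rewrite /coarse e Pn.
move: h1 h2 tj tK; rewrite h3; clear.
case: (leqP (P j) (P n)); lia.
Qed.

End CoarseDistance.

(** * The galaxies of the landmarks *)

Lemma half_sqrt_exists K : exists r, (2 * r ^ 2 <= K < 2 * r.+1 ^ 2)%N.
Proof.
elim: K => [|K [r /andP[h1 h2]]]; first by exists 0%N.
have [h|h] := ltnP K.+1 (2 * r.+1 ^ 2); first by exists r; rewrite h (leq_trans h1).
exists r.+1; rewrite h /=; apply: leq_ltn_trans h2 _.
by rewrite ltn_mul2l /= ltn_sqr.
Qed.

(** r (r + i): for r tending to infinity and i fixed these values, as well as their
    successive differences, tend to infinity. *)
Definition landmark (r : nat) (i : int) : nat := absz (r%:Z * (r%:Z + i))%R.

Lemma landmark_le r i : (absz i <= r)%N -> (landmark r i <= 2 * r ^ 2)%N.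
Proof. by rewrite /landmark -mulnn; nia. Qed.

Lemma landmark_ge r i m : (absz i + m <= r)%N -> (m <= landmark r i)%N.
Proof. by rewrite /landmark; case: r => [|r]; nia. Qed.

Lemma landmark_gap r i j : (absz i <= r)%N -> (absz j <= r)%N -> i < j ->
  (landmark r i + r <= landmark r j)%N.
Proof. by rewrite /landmark; nia. Qed.

Section Galaxies.
Variables (F : set_system nat) (G : prewgraph) (nu rho : rank) (S : wsubgraph G).
Hypothesis (hF : UltraFilter F).
Hypotheses (hG : is_wgraph G nu) (hS : section_like rho S).
Local Notation D := (coarse rho S).
Let FF : ProperFilter F := @ultra_proper _ _ hF.

Definition limited (x y : nat -> G) : Prop :=
  exists m : nat, F [set n | (D (x n) (y n) <= m)%N].

Lemma limitedE (x y : nat -> G) : (forall n, snode S (x n)) -> (forall n, snode S (y n)) ->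
  (exists mu : nat, F [set n | ord_le (wdistance S (x n) (y n))
                      (omega_pow_rank (srank S) *+ mu)]) <-> limited x y.
Proof.
move=> Nx Ny; rewrite (sl_rank hS).
have b m := below_nextMn m (below_next_omega_pow_rank rho).
have mm m : mult rho (omega_pow_rank rho *+ m) = m.
  by rewrite multMn mult_omega_pow_rank mul1n.
split=> -[m Fm].
  exists m; apply: filterS Fm => n /= h.
  by rewrite -(mm m); apply: mult_le h => //; exact: (wdistance_below hS).
exists m.+1; apply: filterS Fm => n /= h.
by apply: ord_le_of_mult; [exact: (wdistance_below hS)|exact: b|rewrite mm].
Qed.

Lemma limited_eq x x' y y' : F [set n | x n = x' n] -> F [set n | y n = y' n] ->
  limited x y -> limited x' y'.
Proof.
move=> Fx Fy [m Fm]; exists m.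
by apply: filterS (filterI (filterI Fx Fy) Fm) => n /= [[-> ->]].
Qed.

Lemma limited_refl x : (forall n, snode S (x n)) -> limited x x.
Proof.
move=> Nx; exists 0%N; apply: filterS filterT => n _ /=.
by rewrite (coarse_refl hS).
Qed.

Lemma hypernode_self g x : node_seq S g x -> eqclass F (node_seq S g) x x.
Proof. by move=> Nx; split=> //; apply: filterS filterT. Qed.

Lemma hypernode_node g h x : is_hypernode F S g h -> h x -> forall n, snode S (x n).
Proof. by move=> [x0 _ ->] [Nx _] n; case: (Nx n). Qed.

Lemma hypernode_eq g h x y : is_hypernode F S g h -> h x -> h y -> F [set n | x n = y n].
Proof.
move=> [x0 _ ->] [_ Fx] [_ Fy]; apply: filterS (filterI Fx Fy) => n /=.
by move=> [<- <-].
Qed.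

(** Hypernodes are classes modulo the filter, so any representatives will do. *)
Lemma limitedly_distant_rep g g' h k x y : is_hypernode F S g h -> is_hypernode F S g' k ->
  h x -> k y -> limitedly_distant F S h k -> limited x y.
Proof.
move=> gh gk hx ky [x' [y' [hx' ky' /limitedE L]]].
apply: limited_eq (L _ _); [exact: hypernode_eq gh hx' hx|exact: hypernode_eq gk ky' ky| |].
  exact: hypernode_node gh hx'.
exact: hypernode_node gk ky'.
Qed.

Lemma limitedly_distant_of g g' h k x y : is_hypernode F S g h -> is_hypernode F S g' k ->
  h x -> k y -> limited x y -> limitedly_distant F S h k.
Proof.
move=> gh gk hx ky L; exists x, y; split=> //; apply/limitedE => //.
  exact: hypernode_node gh hx.
exact: hypernode_node gk ky.
Qed.

Definition hypernode_class (x : nat -> G) := eqclass F (node_seq S rho) x.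

Definition galaxy_at (x : nat -> G) : galaxy G :=
  galaxy_of F S [set k | (exists g', is_hypernode F S g' k) /\
                         limitedly_distant F S (hypernode_class x) k].

Lemma hypernode_class_hypernode x : node_seq S rho x ->
  is_hypernode F S rho (hypernode_class x).
Proof. by move=> Nx; exists x. Qed.

Lemma galaxy_at_galaxy x : node_seq S rho x -> is_galaxy F S (galaxy_at x).
Proof. by move=> Nx; exists rho, (hypernode_class x); split=> //; exact: hypernode_class_hypernode. Qed.

Lemma galaxy_at_self x : node_seq S rho x -> (galaxy_at x).1 (hypernode_class x).
Proof.
move=> Nx; have hx := hypernode_class_hypernode Nx.
split; first by exists rho.
have xx := hypernode_self Nx.
by apply: (limitedly_distant_of hx hx xx xx); apply: limited_refl => n; case: (Nx n).
Qed.

Variable b : G.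
Hypotheses (Nb : snode S b) (rb : nrank b = rho).

(** The coarse wdistance between b and a fixed wnode is finite, so standard
    hypernodes can all be replaced by that of b. *)
Lemma principal_limited g h x : is_hypernode F S g h -> h x ->
  (principal_galaxy F S).1 h -> exists m : nat, F [set n | (D b (x n) <= m)%N].
Proof.
move=> gh hx [_ [k [g' [w [Nw ek]]] L]].
have gk : is_hypernode F S g' k by exists (fun=> w).
have kw : k (fun=> w) by rewrite ek; exact: hypernode_self.
have [m Fm] := limitedly_distant_rep gh gk hx kw L.
have Nw' : snode S w by case: (Nw 0%N).
exists (D b w + m + 6)%N; apply: filterS Fm => n /= le.
have Nx := hypernode_node gh hx n.
have := coarse_triangle hG hS Nb Nw' Nx; rewrite (coarse_sym hS Nw' Nx).
by move: le; clear; lia.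
Qed.

Lemma limited_principal g h x : is_hypernode F S g h -> h x ->
  (exists m : nat, F [set n | (D b (x n) <= m)%N]) -> (principal_galaxy F S).1 h.
Proof.
move=> gh hx [m Fm]; split; first by exists g.
have Nb' : node_seq S rho (fun=> b) by [].
exists (hypernode_class (fun=> b)); first by exists rho, b.
apply: (limitedly_distant_of gh (hypernode_class_hypernode Nb') hx (hypernode_self Nb')).
exists m; apply: filterS Fm => n /=.
by rewrite (coarse_sym hS Nb (hypernode_node gh hx n)).
Qed.

Variables (r : nat -> nat) (u : int -> nat -> G).
Hypothesis r_unbounded : forall m : nat, F [set n | (m <= r n)%N].
Hypothesis u_node : forall i, node_seq S rho (u i).
Hypothesis u_upper : forall i n, (absz i <= r n)%N ->
  (D b (u i n) <= landmark (r n) i + 2)%N.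
Hypothesis u_lower : forall i n, (absz i <= r n)%N ->
  (landmark (r n) i <= D b (u i n) + 6)%N.

Lemma u_unbounded i (m : nat) : F [set n | (m < D b (u i n))%N].
Proof.
apply: filterS (r_unbounded (absz i + (m + 7))%N) => n /= rn.
have := landmark_ge rn; have := @u_lower i n; move: rn; clear; lia.
Qed.

Lemma u_gap i j (m : nat) : i < j -> F [set n | (D b (u i n) + m < D b (u j n))%N].
Proof.
move=> ij; apply: filterS (r_unbounded (absz i + absz j + (m + 9))%N) => n /= rn.
have ri : (absz i <= r n)%N by move: rn; clear; lia.
have rj : (absz j <= r n)%N by move: rn; clear; lia.
have := landmark_gap ri rj ij; have := u_upper ri; have := u_lower rj; move: rn; clear; lia.
Qed.

Lemma galaxy_at_not_principal i : galaxy_at (u i) <> principal_galaxy F S.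
Proof.
move=> e; have := galaxy_at_self (u_node i); rewrite e.
move=> /(principal_limited (hypernode_class_hypernode (u_node i))
  (hypernode_self (u_node i)))[m Fm].
have [n [/= h1 h2]] := filter_ex (filterI Fm (u_unbounded i m)).
by move: h2; rewrite ltnNge h1.
Qed.

Lemma closer_of_lt i j : i < j -> closer F S (galaxy_at (u i)) (galaxy_at (u j)).
Proof.
move=> ij; split; try exact: galaxy_at_galaxy; try exact: galaxy_at_not_principal.
have rA := sl_arrow hS.
have Nb' : node_seq S rho (fun=> b) by [].
have hyper x : node_seq S rho x -> exists2 g, g <> Arrow & is_hypernode F S g (hypernode_class x).
  by move=> Nx; exists rho => //; exact: hypernode_class_hypernode.
exists (hypernode_class (u i)), (hypernode_class (u j)), (hypernode_class (fun=> b)).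
exists (u i), (u j), (fun=> b); split.
- by split; [split; [exact: galaxy_at_self|exact: hyper]|exact: hypernode_self].
- by split; [split; [exact: galaxy_at_self|exact: hyper]|exact: hypernode_self].
- split; [split; [|exact: hyper]|exact: hypernode_self].
  apply: (limited_principal (hypernode_class_hypernode Nb') (hypernode_self Nb')).
  by apply: limited_refl.
move=> m; apply: filterS (u_gap m ij) => n /= h.
have Ni : snode S (u i n) by case: (u_node i n).
have Nj : snode S (u j n) by case: (u_node j n).
rewrite (sl_rank hS); apply: (@ord_le_of_mult rho).
- apply: below_nextD; first exact: (wdistance_below hS).
  exact/below_nextMn/below_next_omega_pow_rank.
- exact: (wdistance_below hS).
- rewrite multD multMn mult_omega_pow_rank mul1n -/(D _ _) -/(D _ _).
  by rewrite (coarse_sym hS Ni Nb) (coarse_sym hS Nj Nb).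
Qed.

(** For j <= i the wdistance of u_j from b exceeds that of u_i by a bounded
    amount at most, and by the triangle inequality so do those of all members of the
    two galaxies, measured from any member of the principal galaxy. *)
Lemma lt_of_closer i j : closer F S (galaxy_at (u i)) (galaxy_at (u j)) -> i < j.
Proof.
move=> [_ _ _ _ [hy [hz [hx [y [z [x [[[yA _] yy] [[zB _] zz] [[xP [g gA gx]] xx]]]]]]]]].
move=> far; rewrite ltNge; apply/negP => ji.
have [[gy hyy] Ly] := yA; have [[gz hzz] Lz] := zB.
have [M1 F1] := limitedly_distant_rep (hypernode_class_hypernode (u_node i)) hyy
  (hypernode_self (u_node i)) yy Ly.
have [M2 F2] := limitedly_distant_rep (hypernode_class_hypernode (u_node j)) hzz
  (hypernode_self (u_node j)) zz Lz.
have [X FX] := principal_limited gx xx xP.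
have Fij : F [set n | (D b (u j n) <= D b (u i n))%N].
  move: ji; rewrite le_eqVlt => /orP[/eqP->|ji]; first by apply: filterS filterT => n _ /=.
  by apply: filterS (u_gap 0 ji) => n /= /ltnW; rewrite addn0.
(* Four triangle inequalities cost 24; one more unit makes the bound fail. *)
have [n [[[/= h1 h2] [h3 h4]] h5]] := filter_ex (filterI
  (filterI (filterI F1 F2) (filterI FX Fij)) (far (M1 + M2 + X + X + 25)%N)).
have Ni : snode S (u i n) by case: (u_node i n).
have Nj : snode S (u j n) by case: (u_node j n).
have Ny := hypernode_node hyy yy n; have Nz := hypernode_node hzz zz n.
have Nx := hypernode_node gx xx n.
rewrite (sl_rank hS) in h5.
have far' : (D (y n) (x n) + (M1 + M2 + X + X + 25) <= D (z n) (x n))%N.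
  have := @mult_le rho _ _ _ _ h5; rewrite multD multMn mult_omega_pow_rank mul1n; apply.
    apply: below_nextD; first exact: (wdistance_below hS).
    exact/below_nextMn/below_next_omega_pow_rank.
  exact: (wdistance_below hS).
have t1 := coarse_triangle hG hS Nz Nj Nx.
have t2 := coarse_triangle hG hS Nj Nb Nx.
have t3 := coarse_triangle hG hS Nb Nx Ni.
have t4 := coarse_triangle hG hS Nx Ny Ni.
rewrite (coarse_sym hS Nz Nj) in t1.
rewrite (coarse_sym hS Nj Nb) in t2.
rewrite (coarse_sym hS Nx Ny) (coarse_sym hS Ny Ni) in t4.
move: far' t1 t2 t3 t4 h1 h2 h3 h4; clear; lia.
Qed.

Lemma landmark_galaxies : exists A : set (galaxy G),
  totally_ordered_by_closeness F S A /\ two_way_infinite_sequence F S A.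
Proof.
have key i j : i < j <-> closer F S (galaxy_at (u i)) (galaxy_at (u j)).
  by split; [exact: closer_of_lt|exact: lt_of_closer].
exists (range (fun i => galaxy_at (u i))); split.
  split.
  - by move=> _ [i _ <-]; exact: galaxy_at_galaxy.
  - by move=> _ [i _ <-] /lt_of_closer; rewrite ltxx.
  - move=> _ _ _ [i _ <-] [j _ <-] [k _ <-] /lt_of_closer ij /lt_of_closer jk.
    by apply: closer_of_lt; exact: lt_trans jk.
  - move=> _ _ [i _ <-] [j _ <-] ne.
    have [ij|ji|e] := ltgtP i j; [left|right|by case: ne; rewrite e]; exact: closer_of_lt.
exists (fun i => galaxy_at (u i)); split=> //; split.
- by move=> i _; exists i.
- move=> i j _ _ e; have [ij|ji|//] := ltgtP i j.
    by have := closer_of_lt ij; rewrite e => /lt_of_closer; rewrite ltxx.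
  by have := closer_of_lt ji; rewrite e => /lt_of_closer; rewrite ltxx.
- by move=> _ [i _ <-]; exists i.
Qed.

End Galaxies.

Theorem theorem5p1 (F : set_system nat) (hF : free_ultrafilter F)
    (nu rho : rank) (G : prewgraph) (S : wsubgraph G)
    (hnu : rle (Fin 2) nu) (hrho : rle rho nu) (hrho_arrow : rho <> Arrow)
    (hG : is_wgraph G nu) (hGconn : wconnected (whole G nu))
    (hS : is_wsection nu rho S)
    (hout : exists v : set (nat -> G),
        is_hypernode F S rho v /\ ~ (principal_galaxy F S).1 v) :
  exists A : set (galaxy G),
    totally_ordered_by_closeness F S A /\ two_way_infinite_sequence F S A.
Proof.
have hU := hF.1.
have sl := wsection_section_like hrho_arrow hrho hG hGconn hS.
have [_ [[v Nv ->] out]] := hout.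
pose b := v 0%N; pose K n := coarse rho S b (v n).
have [Nb rb] : snode S b /\ nrank b = rho := Nv 0%N.
have K_unbounded (m : nat) : F [set n | (m <= K n)%N].
  have [//|small] := in_ultra_setVsetC [set n | (m <= K n)%N] hU.
  case: out; apply: (limited_principal hU sl Nb rb (g := rho) (x := v)).
  - exact: hypernode_class_hypernode.
  - exact: hypernode_self.
  - by exists m; apply: filterS small => n /= /negP; rewrite -ltnNge => /ltnW.
have [r rP] := choice (fun n => half_sqrt_exists (K n)).
have r_unbounded (m : nat) : F [set n | (m <= r n)%N].
  apply: filterS (K_unbounded (2 * m ^ 2)%N) => n /= mK.
  have /andP[_ Kr] := rP n; have := leq_ltn_trans mK Kr.
  by rewrite ltn_mul2l /= ltn_sqr ltnS.
have [u uP] := choice (fun a : int * nat => coarse_intermediate hG sl Nb (Nv a.2).1 (Nv a.2).2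
  (geq_minr (landmark (r a.2) a.1) (K a.2))).
have min_landmark i n : (absz i <= r n)%N -> minn (landmark (r n) i) (K n) = landmark (r n) i.
  move=> ir; apply/minn_idPl; apply: leq_trans (landmark_le ir) _.
  by have /andP[] := rP n.
apply: (@landmark_galaxies F G nu rho S hU hG sl b Nb rb r (fun i n => u (i, n))) => //.
- by move=> i n; have [] := uP (i, n).
- by move=> i n ir; have [_ _ + _] := uP (i, n); rewrite /= min_landmark.
- by move=> i n ir; have [_ _ _] := uP (i, n); rewrite /= min_landmark.
Qed.
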